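(* Let $\mathsf{M}$ be a loopless and coloopless Schubert matroid on $[n]$ of rank $r$. Then \[ g_{\mathsf{M}}(t)=\sum_{i=1}^{r} c_i\,t^i,\] where $c_i$ is the number of admissible Delannoy paths associated to $\mathsf{M}$ having exactly $i-1$ diagonal steps.
   Context: Schubert matroid: for $0\le r\le n$ and an $r$-subset $U\subseteq[n]$, order $r$-subsets by $I=\{i_1<\dots<i_r\}\le J=\{j_1<\dots<j_r\}$ iff $i_\ell\le j_\ell$ for all $\ell$; the Schubert matroid with defining set $U$ is the matroid on $[n]$ whose bases are the $r$-subsets $B$ with $U\le B$. For $P=\{p_1<\dots<p_r\}\subseteq[n]$, $\mathrm{path}(P)$ is the lattice path from $(0,0)$ to $(n-r,r)$ whose $k$-th unit step is north $+(0,1)$ if $k\in P$ and east $+(1,0)$ otherwise. The lattice path representation of $\mathsf{M}$ is the region between $\mathrm{path}(U)$ (upper boundary) and $\mathrm{path}(\{n-r+1,\dots,n\})$ (lower boundary). An admissible Delannoy path associated to $\mathsf{M}$ is a lattice path from $(1,1)$ to $(n-r,r)$ using steps $+(1,0)$, $+(0,1)$ and $+(1,1)$ (diagonal) such that: (i) it stays within the lattice path representation (never above $\mathrm{path}(U)$); (ii) a north step is allowed only if the unit vertical segment it traverses is not a vertical step of $\mathrm{path}(U)$; (iii) a diagonal step from a point is allowed only when a north step from that point would be allowed. The $g$-polynomial: $\mathsf{M}\mapsto g_{\mathsf{M}}(t)\in\mathbb{Z}[t]$ is the unique isomorphism invariant of matroids such that (i) $g_{\mathsf{M}}=0$ if $\mathsf{M}$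 has loops or coloops; (ii) $g_{\mathsf{M}}=t$ if $\mathsf{M}$ is series-parallel on at least two elements (series-parallel: obtained from $\mathsf{U}_{0,1}$ or $\mathsf{U}_{1,1}$ by series and parallel extensions); (iii) $g_{\mathsf{M}_1\oplus\mathsf{M}_2}=g_{\mathsf{M}_1}g_{\mathsf{M}_2}$; (iv) it is a covaluation: whenever the base polytope $\mathscr{P}(\mathsf{M})$ (convex hull of indicator vectors of bases) is subdivided into base polytopes of matroids, $g_{\mathsf{M}}$ equals the sum of $g_{\mathsf{N}}$ over the matroids $\mathsf{N}$ whose polytopes are the internal faces of the subdivision. *)

(* Defs.v *)
From HB Require Import structures.
From mathcomp Require Import all_boot all_order all_algebra.
From mathcomp Require boolp classical_sets reals.

Set Implicit Arguments.
Unset Strict Implicit.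
Unset Printing Implicit Defensive.

Import GRing.Theory.

(** * Matroids, given by their bases *)

Definition is_matroid (E : finType) (Bs : {set {set E}}) : bool :=
  (Bs != set0) &&
  [forall A in Bs, forall B in Bs, forall x in A :\: B,
     exists y in B :\: A, (y |: A :\ x) \in Bs].

Record matroid (E : finType) := Matroid {
  bases : {set {set E}};
  _ : is_matroid bases }.

HB.instance Definition _ (E : finType) := [isSub for @bases E].
HB.instance Definition _ (E : finType) := [Finite of matroid E by <:].

Lemma is_matroidP (E : finType) (Bs : {set {set E}}) :
  reflect (Bs != set0 /\
           forall A B x, A \in Bs -> B \in Bs -> x \in A :\: B ->
             exists2 y, y \in B :\: A & (y |: A :\ x) \in Bs)
          (is_matroid Bs).
Proof.
apply: (iffP andP) => -[-> H]; split=> //.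
  move=> A B x AB BB xAB.
  move/forall_inP: H => /(_ A AB) /forall_inP /(_ B BB) /forall_inP /(_ x xAB).
  by case/exists_inP=> y; exists y.
apply/forall_inP=> A AB; apply/forall_inP=> B BB; apply/forall_inP=> x xAB.
by apply/exists_inP; case: (H A B x AB BB xAB) => y; exists y.
Qed.

Definition indep (E : finType) (M : matroid E) (I : {set E}) : bool :=
  [exists B in bases M, I \subset B].

Definition circuit (E : finType) (M : matroid E) (C : {set E}) : bool :=
  minset (fun X => ~~ indep M X) C.

(* A cocircuit is a circuit of the dual matroid, whose bases are the
   complements of the bases of M; X is contained in no such complement iff it
   meets every basis of M. *)
Definition cocircuit (E : finType) (M : matroid E) (C : {set E}) : bool :=
  minset (fun X => [forall B in bases M, X :&: B != set0]) C.

Definition loop (E : finType) (M : matroid E) (e : E) : bool :=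
  [forall B in bases M, e \notin B].

Definition coloop (E : finType) (M : matroid E) (e : E) : bool :=
  [forall B in bases M, e \in B].

Definition loopless (E : finType) (M : matroid E) : Prop :=
  forall e, ~~ loop M e.

Definition coloopless (E : finType) (M : matroid E) : Prop :=
  forall e, ~~ coloop M e.

Definition matroid_iso (E F : finType) (M : matroid E) (N : matroid F) : Prop :=
  exists2 f : E -> F, bijective f & bases N = [set f @: B | B : {set E} in bases M].

Definition dsum_bases (E F : finType) (M : matroid E) (N : matroid F) :
    {set {set E + F}} :=
  [set inl @: (A : {set E}) :|: inr @: (B : {set F})
     | A in bases M, B in bases N].

Section DirectSumFacts.
Variables (E F : finType).
Implicit Types (A : {set E}) (B : {set F}).

Let join A B : {set E + F} := inl @: A :|: inr @: B.

Local Lemma join_inl A B e : (inl e \in join A B) = (e \in A).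
Proof.
rewrite inE mem_imset; last by move=> ? ? [].
by case: imsetP => [[]//|_]; rewrite orbF.
Qed.

Local Lemma join_inr A B f : (inr f \in join A B) = (f \in B).
Proof.
rewrite inE orbC mem_imset; last by move=> ? ? [].
by case: imsetP => [[]//|_]; rewrite orbF.
Qed.

Lemma dsum_is_matroid (M : matroid E) (N : matroid F) :
  is_matroid (dsum_bases M N).
Proof.
have /is_matroidP[M0 MX] := valP M; have /is_matroidP[N0 NX] := valP N.
apply/is_matroidP; split.
  case/set0Pn: M0 => A AM; case/set0Pn: N0 => B BN'.
  by apply/set0Pn; exists (join A B); apply: imset2_f.
move=> _ _ x /imset2P[A1 B1 A1M B1N ->] /imset2P[A2 B2 A2M B2N ->].
rewrite -!/(join _ _); case: x => [e|f].
- rewrite inE !join_inl => xAB.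
  have [|y yAB yM] := MX A1 A2 e A1M A2M; first by rewrite inE.
  exists (inl y); first by rewrite inE !join_inl; rewrite inE in yAB.
  suff -> : inl y |: join A1 B1 :\ inl e = join (y |: A1 :\ e) B1.
    exact: imset2_f.
  by apply/setP=> -[z|z]; rewrite !(join_inl, join_inr, in_setU1, in_setD1).
- rewrite inE !join_inr => xAB.
  have [|y yAB yM] := NX B1 B2 f B1N B2N; first by rewrite inE.
  exists (inr y); first by rewrite inE !join_inr; rewrite inE in yAB.
  suff -> : inr y |: join A1 B1 :\ inr f = join A1 (y |: B1 :\ f).
    exact: imset2_f.
  by apply/setP=> -[z|z]; rewrite !(join_inl, join_inr, in_setU1, in_setD1).
Qed.

End DirectSumFacts.

Definition direct_sum (E F : finType) (M : matroid E) (N : matroid F) :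
  matroid (E + F)%type := Matroid (dsum_is_matroid M N).

(** * Series-parallel matroids *)

(* In both extensions, iota identifies E with the complement of f.  In a
   parallel extension M is the deletion N \ f; as f lies in the 2-element
   circuit {e, f}, it is not a coloop, so the bases of N \ f are the bases of N
   avoiding f.  Dually, in a series extension M is the contraction N / f, where
   f is not a loop.  The set {e, f} being an actual (co)circuit excludes, e.g.,
   adding a loop "parallel" to a loop. *)
Definition parallel_extension (E F : finType) (M : matroid E) (N : matroid F) :
    Prop :=
  exists (iota : E -> F) (f : F),
    [/\ injective iota, iota @: [set: E] = [set~ f],
        exists2 e, e != f & circuit N [set e; f] &
        forall B : {set E}, (B \in bases M) = (iota @: B \in bases N)].

Definition series_extension (E F : finType) (M : matroid E) (N : matroid F) :
    Prop :=
  exists (iota : E -> F) (f : F),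
    [/\ injective iota, iota @: [set: E] = [set~ f],
        exists2 e, e != f & cocircuit N [set e; f] &
        forall B : {set E}, (B \in bases M) = (f |: iota @: B \in bases N)].

Definition is_uniform (k n : nat) (E : finType) (M : matroid E) : Prop :=
  #|E| = n /\ bases M = [set B : {set E} | #|B| == k].

Inductive series_parallel : forall E : finType, matroid E -> Prop :=
| SP_loop (E : finType) (M : matroid E) :
    is_uniform 0 1 M -> series_parallel M
| SP_coloop (E : finType) (M : matroid E) :
    is_uniform 1 1 M -> series_parallel M
| SP_parallel (E F : finType) (M : matroid E) (N : matroid F) :
    series_parallel M -> parallel_extension M N -> series_parallel N
| SP_series (E F : finType) (M : matroid E) (N : matroid F) :
    series_parallel M -> series_extension M N -> series_parallel N.

(** * Base polytopes and their subdivisions *)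

Section Polytopes.
Import boolp classical_sets reals.
Local Open Scope ring_scope.

Variables (R : realType) (E : finType).
Local Notation V := {ffun E -> R}.
Implicit Types (P F : set V) (M N : matroid E).

Definition indicator (B : {set E}) : V := [ffun e => (e \in B)%:R].

Definition base_polytope M : set V :=
  [set x | exists l : {set E} -> R,
     [/\ forall B, B \in bases M -> 0 <= l B,
         \sum_(B in bases M) l B = 1 &
         forall e, x e = \sum_(B in bases M) l B * indicator B e]]%classic.

Definition dotf (c x : V) : R := \sum_e c e * x e.

(* The empty set and P itself are faces of P. *)
Definition is_face P F : Prop :=
  exists (c : V) (b : R),
    (forall x, P x -> dotf c x <= b) /\
    F = [set x | P x /\ dotf c x = b]%classic.

(* For a polytope P, the boundary relative to the affine hull is the union of
   the proper faces. *)
Definition rel_boundary P : set V :=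
  [set x | exists F, [/\ is_face P F, F <> P & F x]]%classic.

(* S is the set of cells; the faces of the subdivision are the faces of the
   cells. *)
Definition subdivision M (S : {set matroid E}) : Prop :=
  (forall x, base_polytope M x <-> exists2 N, N \in S & base_polytope N x) /\
  (forall N1 N2, N1 \in S -> N2 \in S ->
     let I := (base_polytope N1 `&` base_polytope N2)%classic in
     is_face (base_polytope N1) I /\ is_face (base_polytope N2) I).

Definition internal_face M (S : {set matroid E}) N : Prop :=
  (exists2 C, C \in S & is_face (base_polytope C) (base_polytope N)) /\
  ~ (base_polytope N `<=` rel_boundary (base_polytope M))%classic.

End Polytopes.

(** * The g-polynomial *)

Definition covaluation (R : reals.Real.type)
    (g : forall E : finType, matroid E -> {poly int}) : Prop :=
  forall (E : finType) (M : matroid E) (S : {set matroid E}),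
    subdivision R M S ->
    g E M = (\sum_(N : matroid E | boolp.asbool (internal_face R M S N)) g E N)%R.

Record is_g_polynomial (R : reals.Real.type)
    (g : forall E : finType, matroid E -> {poly int}) : Prop := {
  g_iso : forall (E F : finType) (M : matroid E) (N : matroid F),
    matroid_iso M N -> g E M = g F N;
  g_loop_coloop : forall (E : finType) (M : matroid E) (e : E),
    loop M e \/ coloop M e -> g E M = 0%R;
  g_series_parallel : forall (E : finType) (M : matroid E),
    series_parallel M -> 2 <= #|E| -> g E M = 'X%R;
  g_direct_sum : forall (E F : finType) (M : matroid E) (N : matroid F),
    g _ (direct_sum M N) = (g E M * g F N)%R;
  g_covaluation : covaluation R g }.

(** * Schubert matroids *)

(* The ground set [n] is represented by 'I_n, so the element k of [n] is the
   ordinal k - 1.  The enumeration of a set of ordinals is increasing. *)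
Definition gale_le (n : nat) (I J : {set 'I_n}) : bool :=
  all2 (fun i j : 'I_n => i <= j) (enum I) (enum J).

Definition schubert_bases (n : nat) (U : {set 'I_n}) : {set {set 'I_n}} :=
  [set B : {set 'I_n} | (#|B| == #|U|) && gale_le U B].

(* Number of elements of P among the first k elements of the ground set; this
   is the height of path(P) after k steps. *)
Definition height (n : nat) (P : {set 'I_n}) (k : nat) : nat :=
  #|[set i in P | i < k]|.

Section SchubertFacts.

Local Lemma all2_leq_count (s t : seq nat) :
  sorted ltn s -> sorted ltn t -> size s = size t ->
  all2 leq s t <-> (forall k, count (ltn^~ k) t <= count (ltn^~ k) s).
Proof.
move=> ss st eqst; split.
  move=> + k; elim: s t {ss st} eqst => [|x s IH] [|y t] //= [eqst].
  case/andP=> xy /(IH _ eqst) le_ts; apply: leq_add => //.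
  by case: (ltnP y k) => // yk; rewrite (leq_ltn_trans xy yk).
elim: s t ss st eqst => [|x s IH] [|y t] //= sxs syt [eqst] H.
have minx : all (ltn x) s by apply: (order_path_min ltn_trans).
have miny : all (ltn y) t by apply: (order_path_min ltn_trans).
have lexy : x <= y.
  rewrite leqNgt; apply/negP => ltyx; have := H y.+1.
  have -> : (x < y.+1) = false by rewrite ltnS leqNgt ltyx.
  rewrite ltnSn add0n add1n.
  suff -> : count (ltn^~ y.+1) s = 0 by [].
  apply/eqP; rewrite -leqn0 leqNgt -has_count; apply/hasPn => z zs /=.
  by rewrite -leqNgt (leq_trans ltyx) // ltnW //; exact: (allP minx).
rewrite lexy /=; apply: IH => //; [exact: path_sorted sxs| exact: path_sorted syt|].
move=> k; have := H k; case: (ltnP y k) => yk.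
  by rewrite (leq_ltn_trans lexy yk) leq_add2l.
move=> _; suff -> : count (ltn^~ k) t = 0 by [].
apply/eqP; rewrite -leqn0 leqNgt -has_count; apply/hasPn => z zs /=.
by rewrite -leqNgt (leq_trans yk) // ltnW //; exact: (allP miny).
Qed.

Variable n : nat.
Implicit Types (A B I J U : {set 'I_n}).

Local Lemma sorted_enum_set A : sorted ltn (map val (enum A)).
Proof.
rewrite sorted_map; have -> : enum A = filter (mem A) (enum 'I_n).
  by rewrite enumT.
apply: sorted_filter; first by move=> ? ? ?; exact: ltn_trans.
by rewrite -sorted_map val_enum_ord iota_ltn_sorted.
Qed.

Local Lemma count_enum_set A k : count (ltn^~ k) (map val (enum A)) = height A k.
Proof.
rewrite count_map /height cardE -size_filter.
apply/perm_size/uniq_perm => [||i]; [exact/filter_uniq/enum_uniq|exact: enum_uniq|].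
by rewrite mem_filter !mem_enum [RHS]inE andbC.
Qed.

Lemma gale_leP I J : #|I| = #|J| ->
  reflect (forall k, height J k <= height I k) (gale_le I J).
Proof.
move=> eqIJ; have -> : gale_le I J = all2 leq (map val (enum I)) (map val (enum J)).
  rewrite /gale_le; elim: (enum I) (enum J) => [|x s IH] [|y t] //=.
  by rewrite IH.
have sz : size (map val (enum I)) = size (map val (enum J)).
  by rewrite !size_map -!cardE.
have E := all2_leq_count (sorted_enum_set I) (sorted_enum_set J) sz.
apply: (iffP idP) => [/(proj1 E) H k|H]; first by rewrite -!count_enum_set.
by apply: (proj2 E) => k; rewrite !count_enum_set.
Qed.

Local Lemma height_compl A k :
  #|A| = height A k + #|[set i in A | k <= i]|.
Proof.
rewrite -(cardsID [set i : 'I_n | i < k] A); congr (_ + _); apply: eq_card => i.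
  by rewrite !inE.
by rewrite !inE -leqNgt andbC.
Qed.

Lemma schubert_is_matroid U : is_matroid (schubert_bases U).
Proof.
apply/is_matroidP; split.
  apply/set0Pn; exists U; rewrite inE eqxx /=.
  by apply/gale_leP.
move=> A B x; rewrite !inE => /andP[/eqP cA UA] /andP[/eqP cB UB] /andP[xB xA].
have {}UA := elimT (gale_leP (esym cA)) UA.
have {}UB := elimT (gale_leP (esym cB)) UB.
have cAB : #|A :\: B| = #|B :\: A|.
  have := cardsID B A; have := cardsID A B; rewrite setIC cA cB => <- /eqP.
  by rewrite eqn_add2l => /eqP.
have /card_gt0P[y0 y0BA] : 0 < #|B :\: A|.
  by rewrite -cAB; apply/card_gt0P; exists x; rewrite inE xA xB.
have [y yBA ymax] := @arg_maxnP _ y0 (mem (B :\: A)) (fun i : 'I_n => i : nat) y0BA.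
have := yBA; rewrite !inE => /andP[yA yB].
have nyx : y != x by apply: contraNneq xB => <-.
exists y; first by rewrite inE yA.
have cA' : #|y |: A :\ x| = #|U|.
  by rewrite cardsU1 !inE (negbTE yA) andbF /= -cA [RHS](cardsD1 x) xA.
rewrite inE cA' eqxx /=; apply/gale_leP => // k.
have hD : height (y |: A :\ x) k + (x < k) = height A k + (y < k).
  have hU1 (C : {set 'I_n}) z : z \notin C -> height (z |: C) k = height C k + (z < k).
    move=> zC; rewrite /height addnC; case: ltnP => zk.
      rewrite -[RHS]/(1 + _).
      have <- : z |: [set i in C | i < k] = [set i in z |: C | i < k].
        apply/setP=> i; rewrite !inE; case: eqP => //= ->; by rewrite zk.
      by rewrite cardsU1 inE (negbTE zC).
    apply: eq_card => i; rewrite !inE; case: eqP => //= ->.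
    by rewrite ltnNge zk (negbTE zC).
  rewrite hU1; last by rewrite !inE (negbTE yA) andbF.
  by rewrite addnAC -hU1 ?setD1K // !inE eqxx.
case: (leqP k y) => ky.
  move: hD; rewrite [y < k]ltnNge ky addn0 => hD.
  by apply: leq_trans (UA k); rewrite -hD leq_addr.
case: (ltnP x k) => xk.
  by move: hD; rewrite xk ky => /addIn ->.
move: hD; rewrite [x < k]ltnNge xk ky /= addn0 => ->; apply: leq_trans (UB k).
rewrite -(leq_add2r #|[set i in B | k <= i]|) -height_compl cB -cA.
rewrite (height_compl A k) -addnA leq_add2l add1n.
apply: proper_card; apply/properP; split.
  apply/subsetP => i; rewrite !inE => /andP[iB ki]; rewrite ki andbT.
  apply: contraTT ki => iA; rewrite -ltnNge (leq_ltn_trans _ ky) //.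
  by apply: ymax; rewrite !inE iA.
by exists x; rewrite !inE ?xA ?xk // (negbTE xB).
Qed.

End SchubertFacts.

Definition schubert (n : nat) (U : {set 'I_n}) : matroid 'I_n :=
  Matroid (schubert_is_matroid U).

(** * Admissible Delannoy paths *)

(* Lattice points on the antidiagonal x + y = k are compared with the point of
   each boundary path reached after k steps, namely (k - h, h) with h the height
   after k steps; the lower boundary is the path of the r largest elements. *)
Definition in_region (n : nat) (U : {set 'I_n}) (x y : nat) : bool :=
  let r := #|U| in
  let L := [set i : 'I_n | n - r <= i] in
  [&& x + y <= n, height L (x + y) <= y & y <= height U (x + y)].

(* The segment from (x, y) to (x, y + 1) is a step of path(U). *)
Definition vertical_step (n : nat) (U : {set 'I_n}) (x y : nat) : bool :=
  [exists k : 'I_n, [&& k \in U, x == k - height U k & y == height U k]].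

Definition north_allowed (n : nat) (U : {set 'I_n}) (x y : nat) : bool :=
  in_region U x y.+1 && ~~ vertical_step U x y.

Inductive step := East | North | Diag.

Definition step_code (s : step) : option bool :=
  match s with East => Some true | North => Some false | Diag => None end.
Definition step_decode (c : option bool) : step :=
  match c with Some true => East | Some false => North | None => Diag end.
Lemma step_codeK : cancel step_code step_decode. Proof. by case. Qed.
HB.instance Definition _ := Finite.copy step (can_type step_codeK).

Fixpoint admissible_from (n : nat) (U : {set 'I_n}) (x y : nat) (p : seq step) :
    bool :=
  in_region U x y &&
  match p with
  | [::] => (x == n - #|U|) && (y == #|U|)
  | East :: p' => admissible_from U x.+1 y p'
  | North :: p' => north_allowed U x y && admissible_from U x y.+1 p'
  | Diag :: p' => north_allowed U x y && admissible_from U x.+1 y.+1 p'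
  end.

Definition admissible (n : nat) (U : {set 'I_n}) (p : seq step) : bool :=
  admissible_from U 1 1 p.

(* Every admissible path has fewer than n steps, since each step increases the
   sum of the coordinates, so the bound on the length is not a restriction. *)
Definition delannoy_count (n : nat) (U : {set 'I_n}) (d : nat) : nat :=
  #|[set p : n.-bseq step | admissible U p && (count_mem Diag p == d)]|.

(* Main.v *)
Require Import Defs.
From mathcomp Require Import all_boot all_order all_algebra.
From mathcomp Require Import reals.
From mathcomp Require Import zify ring lra.
From mathcomp Require boolp classical_sets.

Set Implicit Arguments.
Unset Strict Implicit.
Unset Printing Implicit Defensive.

Import Order.TTheory GRing.Theory Num.Theory.

(** Cut the region of a Schubert matroid at the upper right corner (x, y) of its
    current cell: the paths below (x, y), above (x, y) and through (x, y) are the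
    bases of the two cells and of the internal facet of a subdivision, so g is the
    sum of the three contributions. Iterating, the cut freezes a border strip that
    grows by one cell to the east or to the north, and the paths through (x, y)
    form the direct sum of the strip grown so far and of a smaller region of the
    same kind. Border strips are series-parallel, so each contributes a factor t;
    this is the Delannoy recursion, a diagonal step being a new factor.

    For the cuts to be subdivisions one needs the facet description of the base
    polytope of a lattice path matroid: a point satisfying the path inequalities is
    a convex combination of bases, by shifting all fractional partial sums together
    until one of them becomes an integer. *)

(** * Lattice path matroids *)

Section Heights.
Variable n : nat.
Implicit Types (A B P : {set 'I_n}) (h : nat -> nat).

Lemma height0 P : height P 0 = 0.
Proof. by apply: eq_card0 => i; rewrite !inE andbF. Qed.

Lemma heightS P (i : 'I_n) : height P i.+1 = height P i + (i \in P).
Proof.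
rewrite /height (cardsD1 i [set _ in _ | _ < i.+1]) !inE ltnSn andbT addnC.
congr (_ + _); apply: eq_card => j; rewrite !inE ltnS [j < i]ltn_neqAle.
by rewrite andbCA -val_eqE.
Qed.

Lemma height_full P k : n <= k -> height P k = #|P|.
Proof.
move=> nk; apply: eq_card => i; rewrite inE.
by rewrite (leq_trans (ltn_ord i) nk) andbT.
Qed.

Lemma height_step P k : height P k <= height P k.+1 <= (height P k).+1.
Proof.
have [kn|nk] := ltnP k n; first by rewrite (heightS P (Ordinal kn)) /=; lia.
by rewrite !height_full //; lia.
Qed.

Lemma height_slope P j k :
  j <= k -> height P j <= height P k <= height P j + (k - j).
Proof.
elim: k => [|k IH] jk; first by move: jk; rewrite leqn0 => /eqP ->; lia.
have [->|jk'] := eqVneq j k.+1; first lia.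
by have := height_step P k; have := IH ltac:(lia); lia.
Qed.

Lemma height_setU1 P z k :
  z \notin P -> height (z |: P) k = height P k + (z < k).
Proof.
move=> zP; rewrite /height addnC; case: ltnP => zk /=.
  have := cardsU1 z [set i in P | i < k]; rewrite inE (negbTE zP) /= => <-.
  by apply: eq_card => i; rewrite !inE; case: eqP => //= ->.
apply: eq_card => i; rewrite !inE; case: eqP => //= ->.
by rewrite ltnNge zk (negbTE zP).
Qed.

Lemma height_swap A x y k : x \in A -> y \notin A ->
  height (y |: A :\ x) k + (x < k) = height A k + (y < k).
Proof.
move=> xA yA; rewrite height_setU1 ?inE ?(negbTE yA) ?andbF //.
by rewrite addnAC -height_setU1 ?setD1K // !inE eqxx.
Qed.

(** Turns a height function back into a set; bases are constructed below by prescribing their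
    heights. *)
Definition path_set h : {set 'I_n} := [set i : 'I_n | h i < h i.+1].

Definition is_path h : Prop :=
  h 0 = 0 /\ forall k, k < n -> h k <= h k.+1 <= (h k).+1.

Lemma height_path_set h k : is_path h -> k <= n -> height (path_set h) k = h k.
Proof.
move=> [h0 hS]; elim: k => [|k IH] kn; first by rewrite height0.
rewrite (heightS _ (Ordinal kn)) /= (IH (ltnW kn)) inE /=.
by have := hS k kn; lia.
Qed.

(** The bounds need not be lattice paths, so that a cut on one antidiagonal only changes their
    values there. *)
Definition lpm_bases (lo up : nat -> nat) : {set {set 'I_n}} :=
  [set B : {set 'I_n} | [forall k : 'I_n.+1, lo k <= height B k <= up k]].

Lemma lpm_basesP lo up B :
  reflect (forall k, k <= n -> lo k <= height B k <= up k) (B \in lpm_bases lo up).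
Proof.
rewrite inE; apply: (iffP forallP) => H k; last by apply: H; rewrite -ltnS.
by rewrite -ltnS => kn; apply: (H (Ordinal kn)).
Qed.

Lemma path_set_lpm lo up h : is_path h ->
  (forall k, k <= n -> lo k <= h k <= up k) -> path_set h \in lpm_bases lo up.
Proof. by move=> hP H; apply/lpm_basesP => k kn; rewrite height_path_set // H. Qed.

(* For A, B and x in A \ B, the exchanged y is the first place after x, or the
   last one before x, where height A - height B returns to its value at x; on
   which side to look depends on the sign of that value. *)
Lemma lpm_is_matroid lo up B0 : lo n = up n -> B0 \in lpm_bases lo up ->
  is_matroid (lpm_bases lo up).
Proof.
move=> lun B0in; apply/is_matroidP; split; first by apply/set0Pn; exists B0.
move=> A B x /lpm_basesP hA /lpm_basesP hB; rewrite !inE => /andP[xB xA].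
have eqn : height A n = height B n by have := hA n (leqnn n); have := hB n (leqnn n); lia.
have Sx : height A x.+1 = (height A x).+1 by rewrite heightS xA addn1.
have Sx' : height B x.+1 = height B x by rewrite heightS (negbTE xB) addn0.
have xn := ltn_ord x.
have [D|D] := leqP (height B x) (height A x).
- pose Q k := (x < k <= n) && (height A k + height B x <= height B k + height A x).
  have exQ : exists k, Q k by exists n; rewrite /Q; lia.
  case: (ex_minnP exQ) => k /andP[/andP[xk kn] Dk] mink.
  have xk1 : x.+1 < k by rewrite ltn_neqAle xk andbT; apply/eqP => E; move: Dk; rewrite -E; lia.
  have kn' : k.-1 < n by lia.
  have nQ j : x < j < k -> height B j + height A x < height A j + height B x.
    move=> /andP[xj jk]; have [//|E] := ltnP.
    by have := mink j; rewrite /Q xj E andbT; lia.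
  have := heightS A (Ordinal kn'); have := heightS B (Ordinal kn').
  have := nQ k.-1 ltac:(lia); rewrite /= prednK; last lia.
  move=> E1 E2 E3; exists (Ordinal kn'); first by rewrite inE; lia.
  have yA : Ordinal kn' \notin A by lia.
  apply/lpm_basesP => j jn; have := height_swap j xA yA; rewrite /=.
  have := hA j jn; have := hB j jn; have := nQ j; lia.
- pose Q k := (k <= x) && (height B k + height A x < height A k + height B x).
  have exQ : exists k, Q k by exists 0; rewrite /Q !height0; lia.
  have leQ k : Q k -> k <= x by case/andP.
  case: (ex_maxnP exQ leQ) => k /andP[kx Dk] maxk.
  have kx1 : k < x by rewrite ltn_neqAle kx andbT; apply/eqP => E; move: Dk; rewrite E; lia.
  have kn' : k < n by lia.
  have nQ j : k < j <= x -> height A j + height B x <= height B j + height A x.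
    move=> /andP[kj jx]; have [//|E] := leqP.
    by have := maxk j; rewrite /Q jx E /=; lia.
  have := heightS A (Ordinal kn'); have := heightS B (Ordinal kn').
  have := nQ k.+1 ltac:(lia); rewrite /=.
  move=> E1 E2 E3; exists (Ordinal kn'); first by rewrite inE; lia.
  have yA : Ordinal kn' \notin A by lia.
  apply/lpm_basesP => j jn; have := height_swap j xA yA; rewrite /=.
  have := hA j jn; have := hB j jn; have := nQ j; lia.
Qed.

(* The matroid is a junk value when [lpm_bases lo up] is not a matroid. *)
Definition lpm (lo up : nat -> nat) : matroid 'I_n :=
  insubd (schubert set0) (lpm_bases lo up).

Lemma bases_lpm lo up B : lo n = up n -> B \in lpm_bases lo up ->
  bases (lpm lo up) = lpm_bases lo up.
Proof.
by move=> E Bin; rewrite -[bases _]/(val _) val_insubd (lpm_is_matroid E Bin).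
Qed.

Lemma eq_lpm lo up lo' up' :
  lpm_bases lo up = lpm_bases lo' up' -> lpm lo up = lpm lo' up'.
Proof. by rewrite /lpm => ->. Qed.

Lemma lpm_bases_ext lo up lo' up' :
  (forall B, (forall k, k <= n -> lo k <= height B k <= up k) <->
             (forall k, k <= n -> lo' k <= height B k <= up' k)) ->
  lpm_bases lo up = lpm_bases lo' up'.
Proof. by move=> H; apply/setP => B; apply/lpm_basesP/lpm_basesP => /H. Qed.

End Heights.

(** * Base polytopes *)

Section Polytopes.
Local Open Scope ring_scope.
Variables (R : realType) (E : finType).
Local Notation V := {ffun E -> R}.
Implicit Types (c x y z : V) (a b : R) (M N : matroid E) (B : {set E}).

Definition lin2 a x b y : V := [ffun e => a * x e + b * y e].

Lemma dotf_lin2 c a b x y :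
  dotf c (lin2 a x b y) = a * dotf c x + b * dotf c y.
Proof.
rewrite /dotf !mulr_sumr -big_split; apply: eq_bigr => e _.
by rewrite ffunE /=; ring.
Qed.

Lemma dotfN c x : dotf (- c) x = - dotf c x.
Proof. by rewrite /dotf -sumrN; apply: eq_bigr => e _; rewrite ffunE mulNr. Qed.

Lemma dotf_conv M (l : {set E} -> R) c x :
  (forall e, x e = \sum_(B in bases M) l B * indicator R B e) ->
  dotf c x = \sum_(B in bases M) l B * dotf c (indicator R B).
Proof.
move=> xE; rewrite /dotf.
under eq_bigr do rewrite xE mulr_sumr.
rewrite exchange_big; apply: eq_bigr => B _; rewrite mulr_sumr.
by apply: eq_bigr => e _; rewrite mulrCA.
Qed.

Lemma base_polytope_convex M x y a b : 0 <= a -> 0 <= b -> a + b = 1 ->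
  base_polytope M x -> base_polytope M y -> base_polytope M (lin2 a x b y).
Proof.
move=> a0 b0 ab [l [l0 l1 xE]] [l' [l0' l1' yE]].
exists (fun B => a * l B + b * l' B); split.
- by move=> B BM; rewrite addr_ge0 // mulr_ge0 // ?l0 ?l0'.
- by rewrite big_split /= -!mulr_sumr l1 l1' !mulr1.
- move=> e; rewrite ffunE xE yE !mulr_sumr -big_split /=.
  by apply: eq_bigr => B _; ring.
Qed.

Lemma indicator_base_polytope M B :
  B \in bases M -> base_polytope M (indicator R B).
Proof.
move=> BM; exists (fun A => (A == B)%:R); split => [A _|| e].
- exact: ler0n.
- by rewrite (bigD1 B) //= eqxx big1 ?addr0 // => A /andP[_ /negbTE ->].
- rewrite (bigD1 B) //= eqxx mul1r big1 ?addr0 // => A /andP[_ /negbTE ->].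
  by rewrite mul0r.
Qed.

Lemma base_polytope_dotf_le M c b x :
  (forall B, B \in bases M -> dotf c (indicator R B) <= b) ->
  base_polytope M x -> dotf c x <= b.
Proof.
move=> H [l [l0 l1 xE]]; rewrite (dotf_conv c xE).
apply: (@le_trans _ _ (\sum_(B in bases M) l B * b)); last by rewrite -mulr_suml l1 mul1r.
by apply: ler_sum => B BM; rewrite ler_wpM2l ?l0 ?H.
Qed.

(* [c] is positive on B and negative off B, so the indicator of B is its only
   maximiser among 0/1 vectors. *)
Lemma base_polytope_indicator M B :
  base_polytope M (indicator R B) -> B \in bases M.
Proof.
move=> PB; apply/negPn/negP => nB.
pose c : V := [ffun e => if e \in B then 1 else -1].
have cB A : dotf c (indicator R A) = #|B|%:R - #|B :\: A|%:R - #|A :\: B|%:R.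
  rewrite /dotf -!sum1_card !natr_sum (big_mkcond (mem B)) /=.
  rewrite (big_mkcond (mem (B :\: A))) (big_mkcond (mem (A :\: B))) /= -!sumrB.
  apply: eq_bigr => e _; rewrite !ffunE !inE.
  by case: (e \in A); case: (e \in B) => /=; lra.
have : dotf c (indicator R B) <= #|B|%:R - 1.
  apply: base_polytope_dotf_le PB => A AM; rewrite cB.
  have : (0 < #|B :\: A| + #|A :\: B|)%N.
    rewrite addn_gt0 !lt0n !cards_eq0 !setD_eq0 -negb_and -eqEsubset.
    by apply: contraNneq nB => ->.
  by rewrite -(ler_nat R) natrD; lra.
by rewrite cB setDv cards0; lra.
Qed.

Lemma base_polytope_inj M N :
  (forall x, base_polytope (R := R) M x <-> base_polytope N x) -> M = N.
Proof.
move=> H; apply: val_inj; apply/setP => B; apply/idP/idP => BM.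
  by apply: base_polytope_indicator; apply/H/indicator_base_polytope.
by apply: base_polytope_indicator; apply/H/indicator_base_polytope.
Qed.

(** The point is the average of the bases: a functional that attains an upper bound there takes that
    value at every basis. *)
Lemma base_polytope_interior M : exists2 z : V, base_polytope M z &
  forall c b, (forall x, base_polytope M x -> dotf c x <= b) -> dotf c z = b ->
    forall x, base_polytope M x -> dotf c x = b.
Proof.
have /is_matroidP[M0 _] := valP M; rewrite -card_gt0 in M0.
have M0' : 0 < (#|bases M|%:R : R) by rewrite ltr0n.
pose l := fun _ : {set E} => (#|bases M|%:R : R)^-1.
pose z : V := [ffun e => \sum_(B in bases M) l B * indicator R B e].
have zE e : z e = \sum_(B in bases M) l B * indicator R B e by rewrite ffunE.
have l1 : \sum_(B in bases M) l B = 1.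
  by rewrite sumr_const -[LHS]mulr_natr mulVf // lt0r_neq0.
exists z; first by exists l; split=> // B _; rewrite invr_ge0 ler0n.
move=> c b cb zb x Px.
have cB B : B \in bases M -> dotf c (indicator R B) = b.
  move=> BM; have S0 : \sum_(B in bases M) l B * (b - dotf c (indicator R B)) = 0.
    under eq_bigr do rewrite mulrBr.
    by rewrite sumrB -mulr_suml l1 -(dotf_conv c zE) zb mul1r subrr.
  have /eqP : l B * (b - dotf c (indicator R B)) = 0.
    apply: (psumr_eq0P _ S0) => // A AM; rewrite mulr_ge0 ?invr_ge0 ?ler0n //.
    by rewrite subr_ge0; apply/cb/indicator_base_polytope.
  by rewrite mulf_eq0 invr_eq0 gt_eqF //= subr_eq0 => /eqP.
case: Px => m [_ m1 xE]; rewrite (dotf_conv c xE).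
by under eq_bigr => B BM do rewrite cB //; rewrite -mulr_suml m1 mul1r.
Qed.

End Polytopes.

(** * Faces *)

Section Faces.
Import boolp classical_sets.
Local Open Scope ring_scope.
Variables (R : realType) (E : finType).
Local Notation V := {ffun E -> R}.
Implicit Types (P F : set V) (c x y z : V) (b e : R).

Lemma face_refl P : is_face P P.
Proof.
have dot0 x : dotf (0 : V) x = 0.
  by rewrite /dotf big1 // => i _; rewrite ffunE mul0r.
by exists 0, 0; split=> [x _|]; [rewrite dot0|apply/predeqP => x; rewrite /= dot0; split=> [|[]]].
Qed.

Lemma face_hyperplane P c b :
  (forall x, P x -> dotf c x <= b) -> is_face P [set x | P x /\ dotf c x = b]%classic.
Proof. by move=> H; exists c, b. Qed.

Definition lower_half P c b : set V := [set x | P x /\ dotf c x <= b]%classic.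
Definition slice P c b : set V := [set x | P x /\ dotf c x = b]%classic.

(** The point [lin2 (1 + e) x (- e) y] is [x + e (x - y)]: segments of [P] ending at [x] can be
    prolonged within [P]. This expresses relative interiority without affine hulls. *)
Definition rel_open_at P x : Prop :=
  forall y, P y -> exists2 e, 0 < e & P (lin2 (1 + e) x (- e) y).

(** An inequality tight at [x] cuts out a face through [x], which must be all of [P], so it is tight
    at [y] too; a strict one leaves room for all small [e']. The least of finitely many such margins
    serves all inequalities. *)
Lemma polyhedron_rel_open (I : finType) (cs : I -> V) (bs : I -> R) P :
  (forall x, P x <-> forall i, dotf (cs i) x <= bs i) ->
  forall x, P x -> ~ rel_boundary P x -> rel_open_at P x.
Proof.
move=> PE x Px nbd y Py.
have pt i : exists2 e, 0 < e &
    forall e', 0 <= e' <= e -> dotf (cs i) (lin2 (1 + e') x (- e') y) <= bs i.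
  have xi := (PE x).1 Px i; have yi := (PE y).1 Py i.
  have [lt|ge] := ltP (dotf (cs i) x) (bs i).
    pose d := dotf (cs i) x - dotf (cs i) y.
    have [d0|d0] := leP d 0.
      exists 1 => // e' /andP[e0 e1]; rewrite dotf_lin2.
      have : e' * d <= 0 by rewrite mulr_ge0_le0.
      by rewrite /d; lra.
    exists ((bs i - dotf (cs i) x) / d); first by rewrite divr_gt0 // subr_gt0.
    move=> e' /andP[e0]; rewrite ler_pdivlMr // dotf_lin2 /d; lra.
  have xb : dotf (cs i) x = bs i by apply/eqP; rewrite eq_le xi ge.
  have yb : dotf (cs i) y = bs i.
    have cb z : P z -> dotf (cs i) z <= bs i by move/PE.
    have [FP|nFP] := pselect (slice P (cs i) (bs i) = P).
      by move: Py; rewrite -{1}FP => -[].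
    by case: nbd; exists (slice P (cs i) (bs i)); split=> //; exact: face_hyperplane.
  by exists 1 => // e' _; rewrite dotf_lin2 xb yb; lra.
have [e e0 He] : exists2 e, 0 < e &
    forall i, dotf (cs i) (lin2 (1 + e) x (- e) y) <= bs i.
  pose f i := projT1 (cid2 (pt i)).
  have f0 i : 0 < f i by rewrite /f; case: cid2.
  have fP i e' : 0 <= e' <= f i -> dotf (cs i) (lin2 (1 + e') x (- e') y) <= bs i.
    by rewrite /f; case: cid2 => e1 /= _; apply.
  have [i0 _|I0] := pickP (xpredT : pred I).
    pose i1 := [arg min_(i < i0) f i]%O.
    exists (f i1) => // i; apply: fP; rewrite ltW //= /i1.
    by case: arg_minP => // j _; apply.
  by exists 1 => // i; have := I0 i.
by exists e => //; apply/PE.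
Qed.

(* Let p be a point of F in the relative interior of P, y a point of the half,
   and w a point of P beyond p on the line from y. If F has a point z strictly
   below the hyperplane, then w can be replaced by a point of the half on the
   segment from z to w. *)
Lemma half_face P c b F :
  (forall x, P x -> ~ rel_boundary P x -> rel_open_at P x) ->
  (forall x y s t, 0 <= s -> 0 <= t -> s + t = 1 -> P x -> P y -> P (lin2 s x t y)) ->
  is_face (lower_half P c b) F -> ~ (F `<=` rel_boundary P)%classic ->
  F = lower_half P c b \/ F = slice P c b.
Proof.
move=> open conv [d [f [df FE]]] nsub.
have [p Fp pbd] : exists2 p, F p & ~ rel_boundary P p.
  apply: contrapT => H; apply: nsub => p Fp; apply: contrapT => pbd.
  by apply: H; exists p.
have [[Pp pb] pf] : lower_half P c b p /\ dotf d p = f by move: Fp; rewrite FE.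
have {}open := open p Pp pbd.
have [[z Fz zb]|noz] := pselect (exists2 z, F z & dotf c z < b).
  left; apply/predeqP => y; split; first by rewrite FE => -[].
  move=> hy; have [Py yb] := hy; have [e e0 Pw] := open y Py.
  have [[Pz _] zf] : lower_half P c b z /\ dotf d z = f by move: Fz; rewrite FE.
  set w := lin2 _ _ _ _ in Pw.
  have [s /andP[s0 s1] sb] : exists2 s, 0 < s < 1 & (1 - s) * dotf c z + s * dotf c w <= b.
    have [wb|wb] := leP (dotf c w) b; first by exists 2^-1; lra.
    have zw : 0 < dotf c w - dotf c z by lra.
    exists ((b - dotf c z) / (dotf c w - dotf c z)).
      by apply/andP; split; [apply: divr_gt0 => //; lra|rewrite ltr_pdivrMr // mul1r; lra].
    set s := _ / _; have sE : s * (dotf c w - dotf c z) = b - dotf c z.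
      by rewrite /s divfK // gt_eqF.
    lra.
  have hv : lower_half P c b (lin2 (1 - s) z s w).
    by split; [apply: conv => //; lra|rewrite dotf_lin2].
  (* Since [d] equals [f] at [z] and at [p] and is at most [f] at the new point, it is at most [f]
     at [w]; as [p] lies between [y] and [w], it is at least [f] at [y]. *)
  rewrite FE; split=> //; apply/eqP; rewrite eq_le df //=.
  have := df _ hv; rewrite dotf_lin2 zf => H.
  have : s * dotf d w <= s * f by lra.
  rewrite ler_pM2l // /w dotf_lin2 pf => {}H.
  by rewrite -(ler_pM2l e0); lra.
have onF z : F z -> dotf c z = b.
  move=> Fz; have [[_ zb] _] : lower_half P c b z /\ dotf d z = f by move: Fz; rewrite FE.
  by apply/eqP; rewrite eq_le zb leNgt; apply/negP => zb'; apply: noz; exists z.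
right; apply/predeqP => y; split.
  by move=> Fy; split; [move: Fy; rewrite FE => -[[]]|exact: onF].
move=> [Py yb]; have hy : lower_half P c b y by split=> //; rewrite yb.
have [e e0 Pw] := open y Py.
(* A segment inside the hyperplane stays in it when prolonged, hence stays in the half. *)
have hw : lower_half P c b (lin2 (1 + e) p (- e) y).
  by split=> //; rewrite dotf_lin2 yb (onF p) //; lra.
rewrite FE; split=> //; apply/eqP; rewrite eq_le df //=.
by have := df _ hw; rewrite dotf_lin2 pf => H; rewrite -(ler_pM2l e0); lra.
Qed.

End Faces.

(** * Inequalities for the base polytope of a lattice path matroid *)

Section Rounding.
Local Open Scope ring_scope.
Variables (R : realType) (n : nat).
Local Notation V := {ffun 'I_n -> R}.
Implicit Types (x y z : V) (lo up : nat -> nat).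

Definition prefix_vec (k : nat) : V := [ffun i : 'I_n => (i < k)%N%:R].
Definition psum x k : R := dotf (prefix_vec k) x.

Lemma psumE x k : psum x k = \sum_(i < n | (i < k)%N) x i.
Proof.
rewrite /psum /dotf [RHS]big_mkcond; apply: eq_bigr => i _; rewrite ffunE.
by case: ltnP; rewrite ?mul1r ?mul0r.
Qed.

Lemma psum0 x : psum x 0 = 0.
Proof. by rewrite psumE big1. Qed.

Lemma psumS x (i : 'I_n) : psum x i.+1 = psum x i + x i.
Proof.
rewrite !psumE (bigD1 i) ?ltnSn //= addrC; congr (_ + _).
by apply: eq_bigl => j; rewrite ltnS [RHS]ltn_neqAle andbC -val_eqE.
Qed.

Lemma psum_indicator (B : {set 'I_n}) k : psum (indicator R B) k = (height B k)%:R.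
Proof.
rewrite psumE /height -sum1_card natr_sum big_mkcond [RHS]big_mkcond.
by apply: eq_bigr => i _; rewrite !inE !ffunE; case: (i \in B); case: (_ < _)%N.
Qed.

Definition path_polytope lo up x : Prop :=
  (forall i, 0 <= x i <= 1) /\
  (forall k, (k <= n)%N -> (lo k)%:R <= psum x k <= (up k)%:R).

Lemma nonint_floor (z : R) : z \isn't a Num.int ->
  exists2 F, F \is a Num.int &
    F < z < F + 1 /\
    forall a, a \is a Num.int -> (a <= z -> a <= F) /\ (z <= a -> F + 1 <= a).
Proof.
move=> nz; have [F [Fle ltF]] : exists F : int, F%:~R <= z /\ z < (F + 1)%:~R.
  by exists (Num.floor z); split; [exact: floor_le|exact: floorD1_gt].
exists F%:~R; first exact: intr_int.
rewrite intrD in ltF; have neq : F%:~R != z by apply: contraNneq nz => <-; exact: intr_int.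
split=> [|_ /intrP[a ->]]; first by rewrite lt_neqAle neq Fle ltF.
split=> [az|za].
  rewrite ler_int -ltzD1 -(ltr_int R) intrD; lra.
by rewrite -[1]/(1%:~R) -intrD ler_int lezD1 -(ltr_int R) lt_neqAle; apply/andP; split;
  [apply: contraNneq neq => E; rewrite eq_le Fle E za|lra].
Qed.


Definition fractional x k : bool := psum x k \isn't a Num.int.

(** The coordinates are chosen for their effect on partial sums: the fractional ones all move by
    [t], the integral ones stay. *)
Definition shift x (t : R) : V :=
  [ffun i : 'I_n => x i + t * ((fractional x i.+1)%:R - (fractional x i)%:R)].

Lemma psum_shift x t k : (k <= n)%N ->
  psum (shift x t) k = psum x k + t * (fractional x k)%:R.
Proof.
elim: k => [|k IH] kn.
  by rewrite /fractional !psum0 rpred0 mulr0 addr0.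
rewrite (psumS _ (Ordinal kn)) /= (IH (ltnW kn)) (psumS x (Ordinal kn)) ffunE /=.
ring.
Qed.

(* The fractional partial sums can be moved together until one of them hits an
   integer: integral bounds and differences in [0, 1] are respected. *)
Lemma shift_path_polytope lo up x t : path_polytope lo up x ->
  (forall k F, (k <= n)%N -> F \is a Num.int -> F < psum x k < F + 1 ->
     F <= psum x k + t <= F + 1) ->
  path_polytope lo up (shift x t).
Proof.
move=> [x01 xk] ht.
have frac k : (k <= n)%N -> fractional x k -> exists2 F, F \is a Num.int &
    F <= psum x k + t <= F + 1 /\
    forall a, a \is a Num.int -> (a <= psum x k -> a <= F) /\ (psum x k <= a -> F + 1 <= a).
  move=> kn /nonint_floor[F Fint [Fx Fa]]; exists F => //; split=> //.
  exact: ht.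
split=> [i|k kn].
  have xi := x01 i; have Si := psumS x i; have in' := ltn_ord i.
  rewrite ffunE; case si1: (fractional x i.+1); case si: (fractional x i) => /=; try lra.
    (* When exactly one of two neighbouring partial sums is fractional, the other is an end of the
       unit interval around it, their difference being a coordinate in [0, 1]; so the shift keeps
       that difference in [0, 1]. *)
    have [F Fint [Ft Fa]] := frac _ in' si1.
    have ii : psum x i \is a Num.int by move: si => /negbFE.
    have [+ _] := Fa _ ii; have [_] := Fa (psum x i + 1) (rpredD ii (rpred1 _)).
    by move=> H1 H2; have := H1 ltac:(lra); have := H2 ltac:(lra); lra.
  have [F Fint [Ft Fa]] := frac _ (ltnW in') si.
  have ii : psum x i.+1 \is a Num.int by move: si1 => /negbFE.
  have [_] := Fa _ ii; have [+ _] := Fa (psum x i.+1 - 1) (rpredB ii (rpred1 _)).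
  by move=> H1 H2; have := H1 ltac:(lra); have := H2 ltac:(lra); lra.
have := xk k kn; rewrite psum_shift //; case sk: (fractional x k) => /=; last lra.
have [F Fint [Ft Fa]] := frac _ kn sk.
have [+ _] := Fa _ (rpred_nat _ (lo k)); have [_] := Fa _ (rpred_nat _ (up k)).
by move=> H1 H2 H; have := H1 ltac:(lra); have := H2 ltac:(lra); lra.
Qed.

Definition frac_set x : {set 'I_n.+1} := [set k | fractional x (val k)].

Lemma shift_frac_set x t (k : 'I_n.+1) : k \in frac_set x ->
  psum x k + t \is a Num.int -> (#|frac_set (shift x t)| < #|frac_set x|)%N.
Proof.
rewrite inE => sk kt; apply: proper_card; apply/properP; split.
  apply/subsetP => j; rewrite !inE {1}/fractional psum_shift ?leq_ord //.
  by apply: contraNT => /negbTE H; rewrite H mulr0 addr0; move: H => /negbFE.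
exists k; rewrite inE //= /fractional psum_shift ?leq_ord // -/(fractional x k) sk.
by rewrite mulr1 negbK.
Qed.

Lemma integral_path lo up x : path_polytope lo up x -> frac_set x = set0 ->
  exists2 B, B \in lpm_bases n lo up & x = indicator R B.
Proof.
move=> [x01 xk] S0.
have psint k : (k <= n)%N -> psum x k \is a Num.int.
  rewrite -ltnS => kn; apply/negPn/negP => H.
  by have := in_set0 (Ordinal kn); rewrite -S0 inE /fractional H.
have xint i : x i = (x i == 1)%:R.
  have /intrP[a aE] : x i \is a Num.int.
    have -> : x i = psum x i.+1 - psum x i by rewrite psumS; ring.
    by apply: rpredB; apply: psint => //; exact: ltnW.
  have := x01 i; rewrite aE -[0]/(0%:~R) -[1]/(1%:~R) !ler_int eqr_int => a01.
  have [->|->] : a = 0 \/ a = 1 by lia.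
    by [].
  by [].
exists [set i | x i == 1].
  have xB : x = indicator R [set i | x i == 1].
    by apply/ffunP => i; rewrite ffunE inE.
  apply/lpm_basesP => k kn; have := xk k kn.
  by rewrite {1 2}xB psum_indicator !ler_nat.
by apply/ffunP => i; rewrite ffunE inE.
Qed.

(** Move up by the least distance of a fractional partial sum to the next integer, or down by the
    least distance to its floor: the minimising sum becomes integral and no other one crosses an
    integer. *)
Lemma exists_shift lo up x : path_polytope lo up x -> frac_set x != set0 ->
  (exists2 t, 0 < t & path_polytope lo up (shift x t) /\
                      (#|frac_set (shift x t)| < #|frac_set x|)%N) /\
  (exists2 t, 0 < t & path_polytope lo up (shift x (- t)) /\
                      (#|frac_set (shift x (- t))| < #|frac_set x|)%N).
Proof.
move=> Px /set0Pn[k0 k0S].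
pose fl k := (Num.floor (psum x k))%:~R : R.
have flint k : fl k \is a Num.int by exact: intr_int.
have flE k F : F \is a Num.int -> F < psum x k < F + 1 -> F = fl k.
  case/intrP=> a -> /andP[H1 H2]; congr (_%:~R); apply/esym/floor_def.
  by rewrite intrD; lra.
have flS (k : 'I_n.+1) : k \in frac_set x -> fl k < psum x k < fl k + 1.
  rewrite inE => /nonint_floor[F Fint [FF _]].
  by rewrite -(flE k F).
have inS k F : (k <= n)%N -> F \is a Num.int -> F < psum x k < F + 1 ->
    exists2 k' : 'I_n.+1, k' \in frac_set x & val k' = k.
  rewrite -ltnS => kn Fint FF; exists (Ordinal kn) => //; rewrite inE /=.
  apply/negP => kint; move: Fint kint => /intrP[a aE] /intrP[b bE].
  by move: FF; rewrite aE bE -[1]/(1%:~R) -intrD !ltr_int; lia.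
split.
- have [k kS kmin] := arg_minP (fun k : 'I_n.+1 => fl k + 1 - psum x k) k0S.
  have kfl := flS k kS.
  exists (fl k + 1 - psum x k); first lra.
  split; last by apply: (shift_frac_set kS); rewrite addrC subrK rpredD ?rpred1.
  apply: shift_path_polytope => // j F jn Fint FF; have [j' j'S j'E] := inS j F jn Fint FF.
  by have := kmin j' j'S; rewrite j'E -(flE _ _ Fint FF); lra.
- have [k kS kmin] := arg_minP (fun k : 'I_n.+1 => psum x k - fl k) k0S.
  have kfl := flS k kS.
  exists (psum x k - fl k); first lra.
  split; last by apply: (shift_frac_set kS); rewrite opprB addrC subrK.
  apply: shift_path_polytope => // j F jn Fint FF; have [j' j'S j'E] := inS j F jn Fint FF.
  by have := kmin j' j'S; rewrite j'E -(flE _ _ Fint FF); lra.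
Qed.

(** Induction on the number of fractional partial sums: the point lies on the segment between its
    upward and downward shifts, which have fewer; with none left it is the indicator of a basis. *)
Lemma path_polytope_sub lo up M x : bases M = lpm_bases n lo up ->
  path_polytope lo up x -> base_polytope M x.
Proof.
move=> bM; have [N] := ubnP #|frac_set x|; elim: N x => // N IH x xN Px.
have [S0|Sn0] := eqVneq (frac_set x) set0.
  have [B BM ->] := integral_path Px S0.
  by apply: indicator_base_polytope; rewrite bM.
have [[t t0 [Pt St]] [s s0 [Ps Ss]]] := exists_shift Px Sn0.
have ts : t + s != 0 by rewrite gt_eqF // addr_gt0.
have -> : x = lin2 (s / (t + s)) (shift x t) (t / (t + s)) (shift x (- s)).
  by apply/ffunP => i; rewrite !ffunE; field.
apply: base_polytope_convex.
- by rewrite divr_ge0 // ltW // addr_gt0.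
- by rewrite divr_ge0 // ltW // addr_gt0.
- by rewrite -mulrDl [s + t]addrC divff.
- by apply: IH => //; lia.
- by apply: IH => //; lia.
Qed.

(** The inequalities of [path_polytope] as one finite family, the form that [polyhedron_rel_open]
    takes; lower bounds are negated upper bounds. *)
Definition path_ineq_vec (i : bool * ('I_n + 'I_n.+1)) : V :=
  let v := match i.2 with
           | inl j => [ffun l => (l == j)%:R]
           | inr k => prefix_vec k end in
  if i.1 then v else - v.

Definition path_ineq_bound lo up (i : bool * ('I_n + 'I_n.+1)) : R :=
  match i with
  | (true, inl _) => 1
  | (false, inl _) => 0
  | (true, inr k) => (up k)%:R
  | (false, inr k) => - (lo k)%:R
  end.

Lemma path_polytopeE lo up x : path_polytope lo up x <->
  forall i, dotf (path_ineq_vec i) x <= path_ineq_bound lo up i.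
Proof.
have dj (j : 'I_n) : dotf [ffun l => (l == j)%:R] x = x j.
  rewrite /dotf (bigD1 j) //= ffunE eqxx mul1r big1 ?addr0 // => l /negbTE lj.
  by rewrite ffunE lj mul0r.
split=> [[x01 xk] [[] [j|k]] | H] /=; rewrite /path_ineq_vec /= ?dotfN ?dj.
- by have := x01 j; lra.
- by have /andP[] := xk k (leq_ord k).
- by have := x01 j; lra.
- by have /andP[] := xk k (leq_ord k); rewrite lerN2.
split=> [j|k]; last rewrite -ltnS => kn.
  have := H (true, inl j); have := H (false, inl j).
  by rewrite /path_ineq_vec /= dotfN dj; lra.
have := H (true, inr (Ordinal kn)); have := H (false, inr (Ordinal kn)).
by rewrite /path_ineq_vec /= dotfN lerN2 /psum => -> ->.
Qed.

Lemma lpm_polytope lo up M : bases M = lpm_bases n lo up ->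
  forall x, base_polytope M x <-> path_polytope lo up x.
Proof.
move=> bM x; split; last exact: path_polytope_sub.
move=> Px; apply/path_polytopeE => i; apply: base_polytope_dotf_le Px => B.
rewrite bM => /lpm_basesP HB; apply: (path_polytopeE _ _ _).1; split=> [j|k kn].
  by rewrite ffunE; case: (j \in B); rewrite ?ler01 ?lexx.
by rewrite psum_indicator !ler_nat HB.
Qed.

End Rounding.

(** * Splitting by a hyperplane *)

Section HyperplaneSplit.
Import boolp classical_sets.
Local Open Scope ring_scope.
Variables (R : realType) (E : finType).
Local Notation V := {ffun E -> R}.
Local Notation bp := (@base_polytope R E).
Implicit Types (c p q : V) (b : R) (M : matroid E).

(** The segment from a relative interior point [z] to [p] or [q] meets the hyperplane before its far
    end. A supporting functional tight at the meeting point is tight at [z], hence everywhere, so no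
    proper face contains that point. *)
Lemma slice_meets_interior M c b p q :
  bp M p -> bp M q -> dotf c p < b < dotf c q ->
  ~ (slice (bp M) c b `<=` rel_boundary (bp M))%classic.
Proof.
move=> Pp Pq /andP[pb qb] sub; have [z Pz zint] := base_polytope_interior R M.
have toward s v : 0 <= s < 1 -> bp M v -> dotf c (lin2 (1 - s) z s v) = b -> False.
  move=> s01 Pv wb; have Pw : bp M (lin2 (1 - s) z s v).
    by apply: base_polytope_convex => //; lra.
  have [F [[d [f [df FE]]] FP Fw]] := sub _ (conj Pw wb).
  apply: FP; rewrite FE; apply/predeqP => x; split=> [[]//|Px]; split=> //.
  apply: (zint d f df) Px; apply/eqP; rewrite eq_le df //=.
  move: Fw; rewrite FE => -[_]; rewrite dotf_lin2 => E1.
  have s1 : 0 < 1 - s by lra.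
  rewrite -(ler_pM2l s1).
  have : s * dotf d v <= s * f by rewrite ler_wpM2l ?df //; lra.
  lra.
have ratio (u v : R) : (u < b < v) || (v < b < u) ->
    exists2 s, 0 <= s < 1 & (1 - s) * u + s * v = b.
  move=> uv; have vu : v - u != 0 by apply/eqP => H; move: uv; lra.
  exists ((b - u) / (v - u)); last by field.
  case/orP: uv => uv; first by rewrite divr_ge0 ?ltr_pdivrMr ?mul1r /=; lra.
  by rewrite -mulrNN -invrN !opprB divr_ge0 ?ltr_pdivrMr ?mul1r /=; lra.
have [zb|zb|zb] := ltgtP (dotf c z) b.
- have [s s01 sE] := ratio (dotf c z) (dotf c q) ltac:(by rewrite zb qb).
  by apply: (toward s q) => //; rewrite dotf_lin2.
- have [s s01 sE] := ratio (dotf c z) (dotf c p) ltac:(by rewrite zb pb orbT).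
  by apply: (toward s p) => //; rewrite dotf_lin2.
- by apply: (toward 0 q) => //; [lra|rewrite dotf_lin2 zb; ring].
Qed.

(* The internal faces of the subdivision of a polytope by one hyperplane are
   the two halves and their common facet. *)
Lemma g_hyperplane_split (g : forall E : finType, matroid E -> {poly int})
    (M M1 M2 M12 : matroid E) c b p q :
  is_g_polynomial R g ->
  (forall x, bp M x -> ~ rel_boundary (bp M) x ->
     rel_open_at (bp M) x) ->
  bp M1 = lower_half (bp M) c b ->
  bp M2 = lower_half (bp M) (- c) (- b) ->
  bp M12 = slice (bp M) c b ->
  bp M p -> bp M q -> dotf c p < b < dotf c q ->
  g E M = g E M1 + g E M2 + g E M12.
Proof.
move=> hg open P1 P2 P12 Pp Pq pq; have /andP[pb qb] := pq.
have inj (N N' : matroid E) : bp N = bp N' -> N = N'.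
  by move=> H; apply: (@base_polytope_inj R) => x; rewrite H.
have sliceN : slice (bp M) (- c) (- b) = slice (bp M) c b.
  apply/predeqP => x; rewrite /slice /= dotfN.
  by split=> -[? /eqP H]; split=> //; apply/eqP; rewrite ?eqr_opp // -eqr_opp.
have halfNE x : lower_half (bp M) (- c) (- b) x <-> bp M x /\ b <= dotf c x.
  by rewrite /lower_half /= dotfN lerN2.
have I12 : (bp M1 `&` bp M2)%classic = bp M12.
  rewrite P1 P2 P12; apply/predeqP => x; split.
    by move=> [[Px xb] /halfNE[_ bx]]; split=> //; apply/eqP; rewrite eq_le xb bx.
  by move=> [Px xb]; split; [split=> //; rewrite xb|apply/halfNE; rewrite xb].
have F1 : is_face (bp M1) (bp M12).
  rewrite P1 P12; have := @face_hyperplane R E (lower_half (bp M) c b) c b (fun x => @proj2 _ _).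
  congr is_face; apply/predeqP => x; split=> [[[]]|[Px xb]] //.
  by split=> //; split=> //; rewrite xb.
have F2 : is_face (bp M2) (bp M12).
  rewrite P2 P12 -sliceN.
  have := @face_hyperplane R E (lower_half (bp M) (- c) (- b)) (- c) (- b) (fun x => @proj2 _ _).
  congr is_face; apply/predeqP => x; split=> [[[]]|[Px xb]] //.
  by split=> //; split=> //; rewrite xb.
have sub : subdivision R M [set M1; M2].
  split=> [x|N1 N2].
    split=> [Px|[N]].
      have [xb|bx] := leP (dotf c x) b.
        by exists M1; rewrite ?inE ?eqxx // P1.
      by exists M2; rewrite ?inE ?eqxx ?orbT // P2; apply/halfNE; split=> //; exact: ltW.
    by rewrite !inE => /orP[]/eqP->; rewrite ?P1 ?P2 => -[].
  rewrite !inE => /orP[]/eqP-> /orP[]/eqP->; rewrite ?setIid ?I12.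
  - by split; exact: face_refl.
  - by [].
  - by rewrite setIC I12.
  - by split; exact: face_refl.
have nbd12 : ~ (bp M12 `<=` rel_boundary (bp M))%classic.
  by rewrite P12; exact: slice_meets_interior Pp Pq pq.
have intE N : `[< internal_face R M [set M1; M2] N >] = (N \in [set M1; M2; M12]).
  apply/asboolP/idP; last first.
    rewrite !inE -orbA => /or3P[] /eqP ->; split.
    - by exists M1; [rewrite !inE eqxx|exact: face_refl].
    - by move=> H; apply: nbd12 => x; rewrite -I12 => -[] /H.
    - by exists M2; [rewrite !inE eqxx orbT|exact: face_refl].
    - by move=> H; apply: nbd12 => x; rewrite -I12 => -[_] /H.
    - by exists M1; [rewrite !inE eqxx|].
    - by [].
  have conv (x y : V) (s t : R) : 0 <= s -> 0 <= t -> s + t = 1 ->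
    bp M x -> bp M y -> bp M (lin2 s x t y).
    exact: base_polytope_convex.
  rewrite !inE => -[[C]]; rewrite !inE => /orP[]/eqP->.
    rewrite P1 => Nf Nb; have [|] := half_face open conv Nf Nb.
      by rewrite -P1 => /inj ->; rewrite eqxx.
    by rewrite -P12 => /inj ->; rewrite eqxx orbT.
  rewrite P2 => Nf Nb; have [|] := half_face open conv Nf Nb.
    by rewrite -P2 => /inj ->; rewrite eqxx orbT.
  by rewrite sliceN -P12 => /inj ->; rewrite eqxx orbT.
(* The points [p] and [q] tell the three matroids apart, so the sum has exactly three terms. *)
have p1 : bp M1 p by rewrite P1; split=> //; exact: ltW.
have q2 : bp M2 q by rewrite P2; apply/halfNE; split=> //; exact: ltW.
have np2 : ~ bp M2 p by rewrite P2 => /halfNE[_]; lra.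
have np12 : ~ bp M12 p by rewrite P12 => -[_]; lra.
have nq12 : ~ bp M12 q by rewrite P12 => -[_]; lra.
have M1M2 : M1 != M2 by apply/eqP => H; apply: np2; rewrite -H.
have M1M12 : M1 != M12 by apply/eqP => H; apply: np12; rewrite -H.
have M2M12 : M2 != M12 by apply/eqP => H; apply: nq12; rewrite -H.
rewrite (g_covaluation hg sub) (eq_bigl _ _ intE).
rewrite -finset.setUA big_setU1 ?inE ?negb_or ?M1M2 ?M1M12 //=.
by rewrite big_setU1 ?inE //= big_set1 addrA.
Qed.

End HyperplaneSplit.

(** * Cutting a lattice path matroid on an antidiagonal *)

Definition upd (f : nat -> nat) k y j := if j == k then y else f j.

(** The hyperplane fixes the partial sum up to [k] to [y]. The bases [B1] and [B2] lie strictly on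
    its two sides, and [B0], a basis of all three pieces, keeps each [lpm] from its junk value. *)
Lemma g_lpm_split (R : realType) (g : forall E : finType, matroid E -> {poly int})
    (hg : is_g_polynomial R g) n lo up k y (B1 B2 B0 : {set 'I_n}) :
  lo n = up n -> k <= n ->
  B1 \in lpm_bases n lo up -> height B1 k < y ->
  B2 \in lpm_bases n lo up -> y < height B2 k ->
  B0 \in lpm_bases n lo up -> height B0 k = y ->
  (g _ (lpm n lo up) = g _ (lpm n lo (upd up k y)) + g _ (lpm n (upd lo k y) up)
    + g _ (lpm n (upd lo k y) (upd up k y)))%R.
Proof.
move=> lun kn /[dup] B1M /lpm_basesP b1 h1 /[dup] B2M /lpm_basesP b2 h2.
move=> /[dup] B0M /lpm_basesP b0 h0.
have := b1 k kn; have := b2 k kn; have := b0 k kn => h0' h2' h1'.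
have kn' : k < n.
  rewrite ltn_neqAle kn andbT; apply/eqP => E.
  by move: h1 h2 h0' h2' h1'; rewrite E lun; lia.
have updn f : upd f k y n = f n by rewrite /upd; case: eqP => // E; lia.
have bM := bases_lpm lun B0M.
have B01 : B0 \in lpm_bases n lo (upd up k y).
  by apply/lpm_basesP => j jn; have := b0 j jn; rewrite /upd; case: eqP => // ->; lia.
have B02 : B0 \in lpm_bases n (upd lo k y) up.
  by apply/lpm_basesP => j jn; have := b0 j jn; rewrite /upd; case: eqP => // ->; lia.
have B012 : B0 \in lpm_bases n (upd lo k y) (upd up k y).
  by apply/lpm_basesP => j jn; have := b0 j jn; rewrite /upd; case: eqP => // ->; lia.
have bM1 := bases_lpm (etrans lun (esym (updn up))) B01.
have bM2 := bases_lpm (etrans (updn lo) lun) B02.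
have bM12 := bases_lpm (etrans (updn lo) (etrans lun (esym (updn up)))) B012.
have PM := lpm_polytope (R := R) bM.
have dots (B : {set 'I_n}) : dotf (prefix_vec R n k) (indicator R B) = (height B k)%:R%R.
  exact: psum_indicator.
have yb : (lo k <= y)%N /\ (y <= up k)%N by lia.
have [ylo yup] := yb.
have loR : ((lo k)%:R <= y%:R :> R)%R by rewrite ler_nat.
have upR : (y%:R <= (up k)%:R :> R)%R by rewrite ler_nat.
apply: (@g_hyperplane_split R _ g _ _ _ _ (prefix_vec R n k) y%:R%R
          (indicator R B1) (indicator R B2) hg).
- move=> x; apply: polyhedron_rel_open => z; rewrite PM; exact: path_polytopeE.
- apply/boolp.predeqP => x; rewrite (lpm_polytope bM1) /lower_half /= PM.
  split=> [[x01 xk]|[[x01 xk] xy]].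
    split; last by have := xk k kn; rewrite /upd eqxx => /andP[].
    by split=> // j jn; have := xk j jn; rewrite /upd; case: eqP => // -> /andP[-> /le_trans ->].
  by split=> // j jn; have := xk j jn; rewrite /upd; case: eqP => // -> /andP[->].
- apply/boolp.predeqP => x; rewrite (lpm_polytope bM2) /lower_half /= PM dotfN lerN2.
  split=> [[x01 xk]|[[x01 xk] xy]].
    split; last by have := xk k kn; rewrite /upd eqxx => /andP[].
    split=> // j jn; have := xk j jn; rewrite /upd; case: eqP => // -> /andP[H ->].
    by rewrite (le_trans _ H).
  by split=> // j jn; have := xk j jn; rewrite /upd; case: eqP => // -> /andP[_ ->]; rewrite andbT.
- apply/boolp.predeqP => x; rewrite (lpm_polytope bM12) /slice /= PM.
  split=> [[x01 xk]|[[x01 xk] xy]].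
    split; last first.
      by have := xk k kn; rewrite /upd eqxx -/(psum x k) => H; apply/eqP; rewrite eq_le andbC.
    split=> // j jn; have := xk j jn; rewrite /upd; case: eqP => // -> /andP[H H'].
    by rewrite (le_trans _ H) ?(le_trans H').
  split=> // j jn; have := xk j jn; rewrite /upd; case: eqP => // -> _.
  by rewrite /psum xy !lexx.
- by apply: indicator_base_polytope; rewrite bM.
- by apply: indicator_base_polytope; rewrite bM.
- by rewrite !dots !ltr_nat h1 h2.
Qed.

(** * Lattice path matroids through a point *)

Section DirectSum.
Variables (m n : nat).
Implicit Types (B : {set 'I_(m + n)}).

Definition left_part B : {set 'I_m} := [set i | lshift n i \in B].
Definition right_part B : {set 'I_n} := [set i | rshift m i \in B].

Lemma height_left_part B k : k <= m -> height (left_part B) k = height B k.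
Proof.
elim: k => [|k IH] km; first by rewrite !height0.
by rewrite (heightS _ (Ordinal km)) (heightS B (lshift n (Ordinal km))) /= IH ?inE // ltnW.
Qed.

Lemma height_right_part B k : k <= n ->
  height B (m + k) = height B m + height (right_part B) k.
Proof.
elim: k => [|k IH] kn; first by rewrite height0 !addn0.
rewrite addnS (heightS B (rshift m (Ordinal kn))) /= (IH (ltnW kn)).
by rewrite (heightS _ (Ordinal kn)) inE addnA.
Qed.

Definition glue (A : {set 'I_m}) (A' : {set 'I_n}) : {set 'I_(m + n)} :=
  (@unsplit m n) @: (inl @: A :|: inr @: A').

Lemma unsplit_inj : injective (@unsplit m n).
Proof. exact: can_inj (@unsplitK m n). Qed.

Lemma left_part_glue A A' : left_part (glue A A') = A.
Proof.
apply/setP => i; rewrite inE -[lshift n i]/(unsplit (inl i)) mem_imset; last exact: unsplit_inj.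
rewrite inE mem_imset; last by move=> ? ? [].
by case: imsetP => [[]//|_]; rewrite orbF.
Qed.

Lemma right_part_glue A A' : right_part (glue A A') = A'.
Proof.
apply/setP => i; rewrite inE -[rshift m i]/(unsplit (inr i)) mem_imset; last exact: unsplit_inj.
rewrite inE orbC mem_imset; last by move=> ? ? [].
by case: imsetP => [[]//|_]; rewrite orbF.
Qed.

Lemma parts_inj B B' :
  left_part B = left_part B' -> right_part B = right_part B' -> B = B'.
Proof.
move=> /setP L /setP L'; apply/setP => i; rewrite -(splitK i).
by case: (split i) => j /=; [have := L j|have := L' j]; rewrite !inE.
Qed.

Lemma glue_parts B : glue (left_part B) (right_part B) = B.
Proof. by apply: parts_inj; rewrite ?left_part_glue ?right_part_glue. Qed.

(** The hypothesis on [up] makes the truncated subtraction of [y] exact; for [lo] truncation is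
    harmless, since heights are nonnegative. *)
Lemma lpm_bases_through_point lo up y B :
  lo m = y -> up m = y -> (forall k, k <= n -> y <= up (m + k)) ->
  (B \in lpm_bases (m + n) lo up) =
    (left_part B \in lpm_bases m lo up) &&
    (right_part B \in lpm_bases n (fun k => lo (m + k) - y) (fun k => up (m + k) - y)).
Proof.
move=> lom upm yup; apply/lpm_basesP/andP => [H|[/lpm_basesP H1 /lpm_basesP H2] k kmn].
  have Bm : height B m = y by have := H m (leq_addr _ _); lia.
  split; apply/lpm_basesP => k kn; first by rewrite height_left_part // H //; lia.
  by have := H (m + k) ltac:(lia); rewrite height_right_part // Bm; lia.
have [km|mk] := leqP k m; first by rewrite -height_left_part ?H1.
have Bm : height B m = y.
  by have := H1 m (leqnn m); rewrite height_left_part //; lia.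
have kn : k - m <= n by lia.
have := H2 (k - m) kn; have := yup (k - m) kn; have := height_right_part B kn.
by rewrite Bm subnKC; [lia|exact: ltnW].
Qed.

Lemma g_lpm_through_point (R : realType)
    (g : forall E : finType, matroid E -> {poly int}) (hg : is_g_polynomial R g)
    lo up y B :
  lo m = y -> up m = y -> (forall k, k <= n -> y <= up (m + k)) ->
  lo (m + n) = up (m + n) -> B \in lpm_bases (m + n) lo up ->
  (g _ (lpm (m + n) lo up) = g _ (lpm m lo up) *
    g _ (lpm n (fun k => lo (m + k)%N - y)%N (fun k => up (m + k)%N - y)%N))%R.
Proof.
move=> lom upm yup lun Bin; rewrite -(g_direct_sum hg); apply/esym/(g_iso hg).
exists (@unsplit m n); first by exists (@split m n); [exact: unsplitK|exact: splitK].
have := Bin; rewrite (lpm_bases_through_point _ lom upm yup) => /andP[B1 B2].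
rewrite (bases_lpm lun Bin); apply/setP => C.
have b1 : bases (lpm m lo up) = lpm_bases m lo up by apply: bases_lpm B1; lia.
have lun' : lo (m + n) - y = up (m + n) - y by rewrite lun.
have b2 := @bases_lpm _ (fun k => lo (m + k) - y) (fun k => up (m + k) - y) _ lun' B2.
rewrite (lpm_bases_through_point _ lom upm yup) -b1 -b2.
apply/andP/imsetP => [[C1 C2]|[_ /imset2P[A A' A1 A2 ->] ->]].
  exists (inl @: left_part C :|: inr @: right_part C).
    by apply/imset2P; exists (left_part C) (right_part C).
  by rewrite -[RHS]/(glue _ _) glue_parts.
by rewrite -/(glue A A') left_part_glue right_part_glue.
Qed.

End DirectSum.

(** * Border strips *)

(** The first cell sits at the origin, and each further cell lies east (equal value) or north (next
    value) of the one before. *)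
Definition staircase (n : nat) (c : nat -> nat) : Prop :=
  [/\ c 0 = 0, 1 < n -> c 1 = 1 & forall j, j.+1 < n -> c j <= c j.+1 <= (c j).+1].

Lemma staircase_gt0 n c j : staircase n c -> 0 < j < n -> 0 < c j.
Proof.
move=> [_ c1 cS]; elim: j => // -[|j] IH jn; first by rewrite c1; lia.
by have := cS j.+1 ltac:(lia); have := IH ltac:(lia); lia.
Qed.

Lemma staircase_le n c j : staircase n c -> j < n -> c j <= j.
Proof.
move=> [c0 _ cS]; elim: j => [|j IH] jn; first by rewrite c0.
by have := cS j ltac:(lia); have := IH ltac:(lia); lia.
Qed.

(* A border strip of n - 1 cells; c j is the height of the top edge of the cell
   that meets the antidiagonals j - 1, j and j + 1. *)
Definition snake_lo n (c : nat -> nat) j := if j == n then c n.-1 else (c j).-1.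
Definition snake_up n (c : nat -> nat) j := if j == n then c n.-1 else c j.
Definition snake n c : matroid 'I_n := lpm n (snake_lo n c) (snake_up n c).
Definition snake_bases n c := lpm_bases n (snake_lo n c) (snake_up n c).

Lemma snake_basesP n c B :
  reflect (height B n = c n.-1 /\ forall j, j < n -> (c j).-1 <= height B j <= c j)
          (B \in snake_bases n c).
Proof.
rewrite /snake_bases /snake_lo /snake_up.
apply: (iffP (lpm_basesP _ _ _)) => [H|[Hn H] j jn].
  split=> [|j jn]; first by have := H n (leqnn n); rewrite eqxx; lia.
  by have := H j (ltnW jn); rewrite ltn_eqF.
by case: eqP => [->|?]; [rewrite Hn !leqnn|apply: H; lia].
Qed.

Lemma bases_snake n c : 0 < n -> staircase n c -> bases (snake n c) = snake_bases n c.
Proof.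
move=> n0 sc; have [c0 c1 cS] := sc.
pose h j := if j == n then c n.-1 else (c j).-1.
apply: (@bases_lpm _ _ _ (path_set n h)); first by rewrite /snake_lo /snake_up eqxx.
apply: path_set_lpm.
  split=> [|k kn]; rewrite /h; first by rewrite c0; case: eqP => //; lia.
  rewrite ltn_eqF //; case: eqP => [E|E]; first by rewrite -E /=; lia.
  by have := cS k ltac:(lia); lia.
by move=> k kn; rewrite /h /snake_lo /snake_up; case: eqP; lia.
Qed.

Section SnakeExtension.
Variables (n : nat).
Let iota : 'I_n -> 'I_n.+1 := widen_ord (leqnSn n).

Local Lemma iota_inj : injective iota.
Proof. by move=> i j /(congr1 val) /= /val_inj. Qed.

Local Lemma iota_setT : iota @: [set: 'I_n] = [set~ ord_max].
Proof.
apply/setP => i; rewrite !inE; apply/imsetP/idP => [[j _ ->]|ni].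
  by rewrite -val_eqE /= ltn_eqF.
have iltn : i < n by have := ltn_ord i; move: ni; rewrite -val_eqE /=; lia.
by exists (Ordinal iltn) => //; apply: val_inj.
Qed.

Local Lemma height_iota (B : {set 'I_n}) k : k <= n -> height (iota @: B) k = height B k.
Proof.
elim: k => [|k IH] kn; first by rewrite !height0.
rewrite (heightS _ (Ordinal kn)) (heightS _ (iota (Ordinal kn))) /= (IH (ltnW kn)).
by rewrite mem_imset //; exact: iota_inj.
Qed.

Local Lemma max_notin_iota (B : {set 'I_n}) : ord_max \notin iota @: B.
Proof. by apply/imsetP => -[j _ /(congr1 val)] /= E; have := ltn_ord j; lia. Qed.

Local Lemma height_iota_last (B : {set 'I_n}) : height (iota @: B) n.+1 = height B n.
Proof.
by rewrite (heightS _ (@ord_max n)) /= (negbTE (max_notin_iota B)) addn0 height_iota.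
Qed.

(** From antidiagonal [n - 1] to [n + 1] a path in the strip rises by at most one, so no basis
    contains both last elements; the paths ending with an east step are those of the shorter
    strip. *)
Lemma snake_parallel_extension c : 0 < n -> staircase n.+1 c -> c n = c n.-1 ->
  parallel_extension (snake n c) (snake n.+1 c).
Proof.
move=> n0 sc En; have [c0 c1 cS] := sc.
have n1 : 1 < n.
  by have [E|//] := leqP n 1; move: En; (have -> : n = 1 by lia); rewrite c1 //= c0.
have sc' : staircase n c by split=> // [_|j jn]; [apply: c1; lia|apply: cS; lia].
have bM := bases_snake n0 sc'; have bN := bases_snake (ltn0Sn n) sc.
have cn0 : 0 < c n by apply: (staircase_gt0 sc); lia.
have e_lt : n.-1 < n.+1 by lia.
pose e : 'I_n.+1 := Ordinal e_lt.
exists iota, ord_max; split; [exact: iota_inj|exact: iota_setT| |].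
  exists e; first by rewrite -val_eqE /=; lia.
  have nef : e != ord_max by rewrite -val_eqE /=; lia.
  apply/minsetP; split.
    apply/existsP => -[B /andP[]]; rewrite bN => /snake_basesP[/= Bn BS] /subsetP sB.
    have eB : e \in B by apply: sB; rewrite !inE eqxx.
    have fB : ord_max \in B by apply: sB; rewrite !inE eqxx orbT.
    have := heightS B e; have := heightS B ord_max; rewrite eB fB /= prednK //.
    by have := BS n.-1 ltac:(lia); lia.
  move=> X nX sX; apply/eqP; rewrite eqEsubset sX /=; apply/subsetP => i.
  rewrite !inE => /orP[]/eqP ->; apply: contraR nX => nX.
    (* The lower boundary, whose last step is north. *)
    apply/existsP; exists (path_set n.+1 (fun j => if j == n.+1 then c n else (c j).-1)).
    rewrite bN; apply/andP; split.
      apply: path_set_lpm; rewrite /snake_lo /snake_up; last by move=> k kn; case: eqP => //=; lia.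
      split=> [|k kn]; first by rewrite c0.
      rewrite ltn_eqF //; case: eqP => [[->]|E]; first by lia.
      by have := cS k ltac:(lia); lia.
    apply/subsetP => j jX; have /(subsetP sX) := jX; rewrite !inE => /orP[]/eqP E.
      by rewrite -E jX in nX.
    by rewrite E /= eqxx ltn_eqF // prednK.
  (* The lower boundary changed to end with north, east. *)
  apply/existsP; exists (path_set n.+1 (fun j => if n <= j then c n else (c j).-1)).
  rewrite bN; apply/andP; split.
    apply: path_set_lpm; rewrite /snake_lo /snake_up; last first.
      move=> k kn; case: eqP => [->|?]; first by rewrite leqnSn /=; lia.
      by case: (leqP n k) => kn'; [(have -> : k = n by lia)|]; lia.
    split=> [|k kn]; first by rewrite leqNgt n0 c0.
    have [nk|kn1] := leqP n k; first by rewrite leqW //; lia.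
    case: (leqP n k.+1) => [nk|nk]; last by have := cS k ltac:(lia); lia.
    by have Ek : k = n.-1; [lia|rewrite Ek -En; lia].
  apply/subsetP => j jX; have /(subsetP sX) := jX; rewrite !inE => /orP[]/eqP E.
    have nn : (n <= n.-1) = false by lia.
    by rewrite E /= prednK // leqnn nn -En prednK.
  by rewrite -E jX in nX.
move=> B; rewrite bM bN; apply/snake_basesP/snake_basesP => -[Bn BS].
  split=> [|j jn]; first by rewrite height_iota_last Bn.
  rewrite height_iota //; have [->|jn'] := eqVneq j n; first by rewrite Bn En; lia.
  by apply: BS; lia.
rewrite height_iota_last in Bn; split=> [|j jn]; first by rewrite Bn.
by rewrite -height_iota; [apply: BS|]; lia.
Qed.

(** Dually, a path must now rise at least once in its last two steps, so every basis meets the last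
    two elements; the paths ending with a north step are those of the shorter strip. *)
Lemma snake_series_extension c : 0 < n -> staircase n.+1 c -> c n = (c n.-1).+1 ->
  series_extension (snake n c) (snake n.+1 c).
Proof.
move=> n0 sc En; have [c0 c1 cS] := sc.
have sc' : staircase n c by split=> // [?|j jn]; [apply: c1; lia|apply: cS; lia].
have bM := bases_snake n0 sc'; have bN := bases_snake (ltn0Sn n) sc.
have e_lt : n.-1 < n.+1 by lia.
pose e : 'I_n.+1 := Ordinal e_lt.
exists iota, ord_max; split; [exact: iota_inj|exact: iota_setT| |].
  have nef : e != ord_max by rewrite -val_eqE /=; lia.
  exists e => //.
  apply/minsetP; split.
    apply/forall_inP => B; rewrite bN => /snake_basesP[/= Bn BS].
    apply/negP => /eqP EB.
    have eB : e \notin B by apply/negP => H; have := in_set0 e; rewrite -EB !inE eqxx H.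
    have fB : ord_max \notin B.
      by apply/negP => H; have := in_set0 (@ord_max n); rewrite -EB !inE eqxx H orbT.
    have := heightS B e; have := heightS B ord_max.
    rewrite (negbTE eB) (negbTE fB) /= prednK //.
    by have := BS n.-1 ltac:(lia); lia.
  move=> X nX sX; apply/eqP; rewrite eqEsubset sX /=; apply/subsetP => i iX0.
  apply/negPn/negP => iX; move/forall_inP: nX.
  have avoid (B : {set 'I_n.+1}) : B \in snake_bases n.+1 c ->
      (forall j, j \in X -> j \notin B) ->
      ~ (forall B, B \in bases (snake n.+1 c) -> X :&: B != set0).
    move=> BN dj /(_ B); rewrite bN => /(_ BN) /set0Pn[j]; rewrite inE => /andP[jX jB].
    by have := dj j jX; rewrite jB.
  move: iX0 iX; rewrite !inE => /orP[]/eqP -> iX.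
    (* The upper boundary, whose last step is east. *)
    apply: (avoid (path_set n.+1 (fun j => if j == n.+1 then c n else c j))).
      apply: path_set_lpm; rewrite /snake_lo /snake_up; last by move=> k kn; case: eqP => //=; lia.
      split=> [|k kn]; first by rewrite c0.
      rewrite ltn_eqF //; case: eqP => [[->]|E]; first by lia.
      by apply: cS; lia.
    move=> j jX; have /(subsetP sX) := jX; rewrite !inE => /orP[]/eqP E.
      by rewrite -E jX in iX.
    by rewrite E /= eqxx ltn_eqF // ltnn.
  (* The upper boundary changed to end with east, north. *)
  apply: (avoid (path_set n.+1
    (fun j => if j == n.+1 then c n else if j == n then c n.-1 else c j))).
    apply: path_set_lpm; rewrite /snake_lo /snake_up; last first.
      move=> k kn; case: eqP => [_|?] /=; first by lia.
      by case: eqP => [->|?]; lia.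
    split=> [|k kn]; first by rewrite c0 /= ltn_eqF.
    rewrite ltn_eqF // eqSS; case: (k =P n) => [_|E]; first by lia.
    by case: (k.+1 =P n) => [<-|E'] /=; [lia|apply: cS; lia].
  move=> j jX; have /(subsetP sX) := jX; rewrite !inE => /orP[]/eqP E; last by rewrite -E jX in iX.
  by rewrite E /= prednK // eqxx !ltn_eqF ?ltnn //; lia.
move=> B; rewrite bM bN; apply/snake_basesP/snake_basesP => -[Bn BS].
  split=> [|j jn]; rewrite height_setU1 ?max_notin_iota //=.
    by rewrite ltnSn height_iota_last Bn En addn1.
  rewrite height_iota //; have [->|jn'] := eqVneq j n; first by rewrite Bn En ltnn; lia.
  by have := BS j; lia.
rewrite height_setU1 ?max_notin_iota //= ltnSn height_iota_last in Bn.
split=> [|j jn]; first by lia.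
have := BS j ltac:(lia); rewrite height_setU1 ?max_notin_iota //= height_iota; lia.
Qed.

End SnakeExtension.

(** Starting from a loop, the cells are added one by one: a parallel extension for a cell to the
    east, a series extension for a cell to the north. *)
Lemma snake_series_parallel n c : 0 < n -> staircase n c -> series_parallel (snake n c).
Proof.
elim: n => // -[_ _ sc|n IH _ sc].
  apply: SP_loop; split; first by rewrite card_ord.
  rewrite bases_snake //; apply/setP => B; have [c0 _ _] := sc.
  rewrite [RHS]inE -(height_full B (leqnn 1)); apply/snake_basesP/eqP => [[->//]|B0].
  by split=> [|[|//] _]; rewrite /= c0 ?height0.
have [c0 c1 cS] := sc.
have sc' : staircase n.+1 c by split=> // [?|j jn]; [apply: c1; lia|apply: cS; lia].
have := cS n (ltnSn _); have [E _|E H] := eqVneq (c n.+1) (c n).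
  by apply: SP_parallel (IH _ sc') _ => //; apply: snake_parallel_extension.
by apply: SP_series (IH _ sc') _ => //; apply: snake_series_extension => //=; lia.
Qed.

(** * The Delannoy recursion *)

(** The bound 0 from [m] on suffices: having to reach height [r] at [n] already enforces the lower
    boundary path. *)
Definition strip_lo n r m (c : nat -> nat) j :=
  if j == n then r else if j < m then (c j).-1 else 0.
Definition strip_up n r (u : nat -> nat) m (c : nat -> nat) j :=
  if j == n then r else if j < m then c j else u j.

Definition strip_bases n r u m c :=
  lpm_bases n (strip_lo n r m c) (strip_up n r u m c).

(* The paths that stay inside the border strip given by c up to the
   antidiagonal m, and only below u afterwards. *)
Definition strip n r u m c : matroid 'I_n :=
  lpm n (strip_lo n r m c) (strip_up n r u m c).

Lemma strip_basesP n r u m c (B : {set 'I_n}) :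
  (forall k, k <= n -> strip_lo n r m c k <= height B k <= strip_up n r u m c k) <->
  [/\ height B n = r,
      forall j, j < n -> j < m -> (c j).-1 <= height B j <= c j &
      forall j, j < n -> m <= j -> height B j <= u j].
Proof.
rewrite /strip_lo /strip_up; split=> [H|[Hn H1 H2] k kn].
  split=> [|j jn jm|j jn jm].
  - by have := H n (leqnn n); rewrite eqxx; lia.
  - by have := H j (ltnW jn); rewrite ltn_eqF // jm.
  - by have := H j (ltnW jn); rewrite ltn_eqF // ltnNge jm.
case: eqP => [->|kn']; first by rewrite Hn !leqnn.
case: ltnP => km; first by apply: H1 => //; lia.
by rewrite H2 //; lia.
Qed.

(** The properties of the upper path of a loopless and coloopless Schubert matroid that pass to the
    smaller regions; the third keeps it strictly above the lower boundary [j + r - n]. *)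
Definition upper_bound n r (u : nat -> nat) : Prop :=
  [/\ forall i j, i <= j -> u i <= u j, 0 < u 1,
      forall j, 0 < j < n -> j + r < u j + n, forall j, u j <= r & r < n].

(** From height [v] at [m] the path goes east as long as the end point stays reachable, then north;
    hence the maximum of [v] and [j + r - n]. *)
Lemma strip_witness n r u m c p v : upper_bound n r u -> 1 < m < n ->
  p 0 = 0 -> (forall j, j.+1 < m -> p j <= p j.+1 <= (p j).+1) ->
  (forall j, j < m -> (c j).-1 <= p j <= c j) ->
  p m.-1 <= v <= (p m.-1).+1 -> m + r <= n + v -> v <= u m ->
  exists2 B, B \in strip_bases n r u m c & height B m = v.
Proof.
move=> [umono u1 ulow ur rn] /andP[m1 mn] p0 pS pc pv mv vu.
have vr := ur m.
pose h j := if j < m then p j else maxn v (j + r - n).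
have hP : is_path n h.
  split=> [|k kn]; first by rewrite /h ltnW.
  rewrite /h; have [km|km] := ltnP k.+1 m; first by (have -> : k < m by lia); exact: pS.
  have [km'|km'] := ltnP k m; last by lia.
  by have Ek : k = m.-1; [lia|rewrite Ek; lia].
exists (path_set n h); last first.
  by rewrite height_path_set ?(ltnW mn) // /h ltnn; lia.
apply/lpm_basesP/strip_basesP; split=> [|j jn jm|j jn jm].
- by rewrite height_path_set // /h ltnNge ltnW //=; lia.
- by rewrite height_path_set ?(ltnW jn) // /h jm pc.
- rewrite height_path_set ?(ltnW jn) // /h ltnNge jm /=.
  by have := umono m j jm; have := ulow j ltac:(lia); lia.
Qed.

Section DelannoyPolynomial.
Local Open Scope ring_scope.
Variables (u : nat -> nat) (n r : nat).

(* Generating polynomial, by number of diagonal steps, of the admissible paths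
   of at most k steps from (x, y) to (n - r, r); a north step from (x, y) is
   allowed iff y < u (x + y). *)
Fixpoint delannoy_poly (k x y : nat) : {poly int} :=
  if (x + r <= n)%N then
    ((x + r == n)%N && (y == r))%:R +
    (if k is k'.+1 then
       delannoy_poly k' x.+1 y +
       (if (y < u (x + y))%N
        then delannoy_poly k' x y.+1 + 'X * delannoy_poly k' x.+1 y.+1 else 0)
     else 0)
  else 0.

Lemma delannoy_poly_out k x y : (n < x + r)%N -> delannoy_poly k x y = 0.
Proof. by case: k => [|k] H /=; rewrite leqNgt H. Qed.

End DelannoyPolynomial.

(** Moves the origin to [(x, y)], as needed for the region that remains after passing through that
    point. *)
Lemma delannoy_poly_shift u n r x y k a b :
  delannoy_poly (fun j => u (x + y + j) - y) n r k a b =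
  delannoy_poly u (x + y + n) (y + r) k (x + a) (y + b).
Proof.
elim: k a b => [|k IH] a b /=.
  have -> : (x + a + (y + r) <= x + y + n) = (a + r <= n) by lia.
  have -> : (x + a + (y + r) == x + y + n) = (a + r == n) by lia.
  by rewrite eqn_add2l.
have -> : (x + a + (y + r) <= x + y + n) = (a + r <= n) by lia.
have -> : (x + a + (y + r) == x + y + n) = (a + r == n) by lia.
have -> : x + a + (y + b) = x + y + (a + b) by lia.
have -> : (y + b < u (x + y + (a + b))) = (b < u (x + y + (a + b)) - y) by lia.
by rewrite !IH eqn_add2l !addnS.
Qed.

Section MainRecursion.
Variables (R : realType) (g : forall E : finType, matroid E -> {poly int}).
Hypothesis hg : is_g_polynomial R g.

Lemma strip_snake n r u c : 0 < n -> c n.-1 = r -> strip n r u n c = snake n c.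
Proof.
move=> n0 cr; apply: eq_lpm; apply: lpm_bases_ext => B.
split=> H k kn; have := H k kn; rewrite /strip_lo /strip_up /snake_lo /snake_up -cr.
  by case: eqP => // ?; have -> : k < n by lia.
by case: eqP => // ?; have -> : k < n by lia.
Qed.

Lemma g_snake n c : 1 < n -> staircase n c -> g (snake n c) = 'X%R.
Proof.
move=> n1 sc; apply: (g_series_parallel hg); last by rewrite card_ord.
by apply: snake_series_parallel => //; exact: ltnW.
Qed.

Definition extend m (c : nat -> nat) v j := if j < m then c j else v.

Lemma staircase_extend m c v : 1 < m -> staircase m c ->
  c m.-1 <= v <= (c m.-1).+1 -> staircase m.+1 (extend m c v).
Proof.
move=> m1 [c0 c1 cS] cv; rewrite /extend; split=> [|_|j jm]; first by rewrite ltnW.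
  by rewrite m1 c1.
have [jm'|jm'] := ltnP j.+1 m; first by (have -> : j < m by lia); exact: cS.
have Ej : j = m.-1 by lia.
by (have -> : j < m by lia); rewrite Ej.
Qed.

(** The bounds on antidiagonal [m] are compared only for paths of rank [r] that are inside the strip
    at [m - 1]: those implied by unit slopes need not agree literally. *)
Lemma strip_extend n r u m c v lo up : 1 < m < n -> staircase m c ->
  (forall B : {set 'I_n},
    (height B m.-1 <= c m.-1 -> (c m.-1).-1 <= height B m.-1 -> height B n = r ->
     (lo m <= height B m <= up m) = (v.-1 <= height B m <= v))) ->
  (forall j, j != m -> lo j = strip_lo n r m c j /\ up j = strip_up n r u m c j) ->
  lpm n lo up = strip n r u m.+1 (extend m c v).
Proof.
move=> /andP[m1 mn] sc Hm Hj; apply: eq_lpm; apply: lpm_bases_ext => B.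
rewrite strip_basesP; split=> [H|[Bn H1 H2] j jn].
  have Hs j : j <= n -> j != m -> strip_lo n r m c j <= height B j <= strip_up n r u m c j.
    by move=> jn jm; have [<- <-] := Hj j jm; apply: H.
  have Bn : height B n = r.
    by have := Hs n (leqnn n) ltac:(lia); rewrite /strip_lo /strip_up eqxx; lia.
  have Bm : (c m.-1).-1 <= height B m.-1 <= c m.-1.
    have := Hs m.-1 ltac:(lia) ltac:(lia); rewrite /strip_lo /strip_up.
    by (have -> : (m.-1 == n) = false by lia); have -> : m.-1 < m by lia.
  split=> // j jn jm; rewrite /extend; last first.
    have := Hs j (ltnW jn) ltac:(lia); rewrite /strip_lo /strip_up ltn_eqF //.
    by have -> : (j < m) = false by lia.
  case: (ltnP j m) => jm'.
    by have := Hs j (ltnW jn) ltac:(lia); rewrite /strip_lo /strip_up ltn_eqF // jm'.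
  have -> : j = m by lia.
  by rewrite -Hm; [apply: H; lia|lia|lia|].
have cB i : i < m -> (c i).-1 <= height B i <= c i.
  by move=> im; have := H1 i ltac:(lia) ltac:(lia); rewrite /extend im.
have [->|jm] := eqVneq j m.
  rewrite Hm //; [|by have := cB m.-1 ltac:(lia); lia..].
  by have := H1 m mn (ltnSn m); rewrite /extend ltnn.
have [-> ->] := Hj j jm; rewrite /strip_lo /strip_up.
case: eqP => [->|jn']; first by rewrite Bn leqnn.
by case: ltnP => jm'; [apply: cB|apply: H2; lia].
Qed.

(** Before the point lies a complete border strip, contributing ['X]. After it, a strip of one cell
    at the new origin, which constrains no path beyond the upper bound. *)
Lemma g_strip_through_point m n r u c y (B : {set 'I_(m + n)}) :
  1 < m -> 0 < n -> staircase m c -> c m.-1 = y ->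
  (forall i j, i <= j -> u i <= u j) -> y < u m ->
  let lo := upd (strip_lo (m + n) (y + r) m c) m y in
  let up := upd (strip_up (m + n) (y + r) u m c) m y in
  B \in lpm_bases (m + n) lo up ->
  g (lpm (m + n) lo up) =
    ('X * g (strip n r (fun j => u (m + j)%N - y)%N 2 (fun j => 0 < j)%N))%R.
Proof.
move=> m1 n0 sc cy umono yum lo up Bin.
have mn j : (m + j == m) = (j == 0) by lia.
have mnn j : (m + j == m + n) = (j == n) by lia.
have mnm j : (m + j < m) = false by lia.
have lom : lo m = y by rewrite /lo /upd eqxx.
have upm : up m = y by rewrite /up /upd eqxx.
have yup k : k <= n -> y <= up (m + k).
  move=> kn; rewrite /up /upd mn; case: eqP => // _; rewrite /strip_up mnn mnm.
  case: eqP => _; first exact: leq_addr.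
  by have := umono m (m + k) (leq_addr _ _); lia.
have ends : lo (m + n) = up (m + n).
  by rewrite /lo /up /upd /strip_lo /strip_up mn mnn eqxx.
apply: (etrans (g_lpm_through_point hg lom upm yup ends Bin)).
apply: (congr2 *%R).
  apply: etrans (g_snake m1 sc); apply: (congr1 (@g _)); apply: eq_lpm.
  apply: lpm_bases_ext => A.
  rewrite /lo /up /upd /strip_lo /strip_up /snake_lo /snake_up cy; split=> H k km; have := H k km;
    (case: (k =P m) => // kneq; have -> : k < m by lia);
    by have -> : (k == m + n) = false by lia.
apply: (congr1 (@g _)); apply: eq_lpm; apply: lpm_bases_ext => A; rewrite strip_basesP.
rewrite /lo /up /upd /strip_lo /strip_up; split=> [H|[Hn H1 H2] j jn].
  split=> [|[|[|//]] jn _|j jn j2].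
  - by have := H n (leqnn n); rewrite mn mnn eqxx gtn_eqF //; lia.
  - by rewrite height0.
  - by have := height_step A 0; rewrite height0; lia.
  - by have := H j (ltnW jn); rewrite mn mnn mnm gtn_eqF 1?ltn_eqF //; lia.
rewrite mn mnn mnm; case: (posnP j) => [->|j0]; first by rewrite height0; lia.
case: (j =P n) => [->|jn'] /=; first by rewrite Hn; lia.
have [j2|j2] := ltnP j 2; last by apply: H2; lia.
have := H1 j ltac:(lia) j2; have := umono m (m + j) (leq_addr _ _).
by rewrite j0; lia.
Qed.

(** The last cell has upper right corner [(m - c m.-1, c m.-1)]. Growing the strip east or north and
    passing through the corner match the three steps of [delannoy_poly]; [k] bounds the number of
    antidiagonals left. *)
Lemma g_strip k n r u m c : upper_bound n r u -> 1 < m <= n -> staircase m c ->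
  c m.-1 <= u m.-1 -> m + r <= n + c m.-1 -> n <= m + k ->
  g (strip n r u m c) = ('X * delannoy_poly u n r k (m - c m.-1) (c m.-1))%R.
Proof.
elim: k n r u m c => [|k IH] n r u m c ub /andP[m1 mn] sc yu mr nmk;
  have [umono u1 ulow ur rn] := ub; have yr := ur m.-1;
  have ym := staircase_le sc (ltac:(lia) : m.-1 < m);
  have y0 := staircase_gt0 sc (ltac:(lia) : 0 < m.-1 < m);
  set y := c m.-1 in yu mr yr ym y0 *; have [mn'|mn'] := eqVneq m n; try lia.
(* The strip is complete and its corner is the end point, so the polynomial is 1. *)
- have Ey : y = r by lia.
  rewrite /= mn' strip_snake -?mn' ?g_snake //; [|lia..].
  have -> : m - y + r = m by lia.
  by rewrite leqnn Ey !eqxx addr0 mulr1.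
- have Ey : y = r by lia.
  rewrite /= mn' strip_snake -?mn' ?g_snake //; [|lia..].
  have -> : m - y + r = m by lia.
  rewrite delannoy_poly_out; last by lia.
  have -> : (y < u (m - y + y)) = false by have := ur (m - y + y); lia.
  by rewrite leqnn Ey !eqxx !addr0 mulr1.
have {mn mn'} mn : m < n by lia.
have um := umono m.-1 m (leq_pred m).
set x := m - y; have xy : x + y = m by rewrite /x; lia.
have north : y < u m -> x + r <= n ->
    g (strip n r u m.+1 (extend m c y.+1)) = ('X * delannoy_poly u n r k x y.+1)%R.
  move=> yum xr; have yrm := ur m.
  have := IH n r u m.+1 (extend m c y.+1); rewrite /extend /= ltnn subSS; apply=> //; try lia.
  by apply: staircase_extend => //; rewrite /y; lia.
have east : x.+1 + r <= n ->
    g (strip n r u m.+1 (extend m c y)) = ('X * delannoy_poly u n r k x.+1 y)%R.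
  move=> xr; have := IH n r u m.+1 (extend m c y); rewrite /extend /= ltnn subSn; last lia.
  apply=> //; try lia.
  by apply: staircase_extend => //; rewrite /y; lia.
have m1n : 1 < m < n by rewrite m1.
have lom : strip_lo n r m c m = 0 by rewrite /strip_lo ltnn ltn_eqF.
have upm : strip_up n r u m c m = u m by rewrite /strip_up ltnn ltn_eqF.
rewrite [delannoy_poly _ _ _ _ _ _]/= xy.
have -> : (x + r <= n) by rewrite /x; lia.
have -> : (x + r == n) && (y == r) = false by rewrite /x; lia.
rewrite add0r.
(* On the right boundary every path has height at least [y] at [m]: there is nothing to cut and the
   strip grows north. *)
have [xr|xr] := eqVneq (x + r) n.
  have yum : y < u m by have := ulow m ltac:(lia); rewrite /x in xr; lia.
  rewrite yum !(delannoy_poly_out _ _ _ (x := x.+1)) ?addSn ?xr // mulr0 add0r addr0.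
  apply: etrans (north yum _); last by rewrite xr.
  apply: (congr1 (@g _)); apply: strip_extend => // B; rewrite -/y lom upm => B1 B2 Bn.
  have := height_slope B (leq_pred m); have := height_slope B (ltnW mn).
  by rewrite Bn; lia.
have {}xr : x.+1 + r <= n by rewrite /x in xr *; lia.
(* If the corner is on the upper path, no path passes above it and the strip grows east. *)
have [yum|yum] := ltnP y (u m); last first.
  rewrite addr0; apply: etrans (east xr).
  apply: (congr1 (@g _)); apply: strip_extend => // B; rewrite -/y lom upm => B1 B2 Bn.
  by have := height_slope B (leq_pred m); lia.
have [c0 c1 cS] := sc; have yrm := ur m.
(* Bases below, through and above the corner: the first two follow the lower boundary of the strip
   up to [m - 1], the third its upper boundary. *)
have [B1 B1M B1h] : exists2 B : {set 'I_n}, B \in strip_bases n r u m c & height B m = y.-1.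
  apply: (@strip_witness _ _ _ _ _ (fun j => (c j).-1)) => //; rewrite -?/y ?c0 //; try lia.
  by move=> j jm; have := cS j jm; lia.
have [B0 B0M B0h] : exists2 B : {set 'I_n}, B \in strip_bases n r u m c & height B m = y.
  apply: (@strip_witness _ _ _ _ _ (fun j => (c j).-1)) => //; rewrite -?/y ?c0 //; try lia.
  by move=> j jm; have := cS j jm; lia.
have [B2 B2M B2h] : exists2 B : {set 'I_n}, B \in strip_bases n r u m c & height B m = y.+1.
  by apply: (@strip_witness _ _ _ _ _ c) => //; rewrite -?/y ?c0 //; lia.
have ends : strip_lo n r m c n = strip_up n r u m c n by rewrite /strip_lo /strip_up eqxx.
have [B1y B2y] : height B1 m < y /\ y < height B2 m by rewrite B1h B2h; lia.
apply: (etrans (g_lpm_split hg ends (ltnW mn) B1M B1y B2M B2y B0M B0h)).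
rewrite !mulrDr addrA; apply: (congr2 +%R); first apply: (congr2 +%R).
- apply: etrans (east xr); apply: (congr1 (@g _)); apply: strip_extend => //; last by move=> j /negbTE jm; rewrite /upd jm.
  move=> B; rewrite -/y /upd eqxx lom => A1 A2 Bn.
  by have := height_slope B (leq_pred m); lia.
- apply: etrans (north yum (ltnW xr)); apply: (congr1 (@g _)).
  apply: strip_extend => //; last by move=> j /negbTE jm; rewrite /upd jm.
  move=> B; rewrite -/y /upd eqxx upm => A1 A2 Bn.
  by have := height_slope B (leq_pred m); lia.
have B0M' : B0 \in lpm_bases n (upd (strip_lo n r m c) m y) (upd (strip_up n r u m c) m y).
  move/lpm_basesP: B0M => B0M; apply/lpm_basesP => j jn; have := B0M j jn; rewrite /upd.
  by case: eqP => // -> _; rewrite B0h leqnn.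
have [n' En] : exists n', n = m + n' by exists (n - m); lia.
have [r' Er] : exists r', r = y + r' by exists (r - y); lia.
have := @delannoy_poly_shift u n' r' x y k 1 1; rewrite xy -En -Er !addn1 => <-.
subst n r.
have n'0 : 0 < n' by lia.
apply: (etrans (g_strip_through_point m1 n'0 sc (erefl y) umono yum B0M')).
apply: (congr2 *%R) => //.
(* The region beyond the corner starts anew with its first cell, hence [m = 2]. *)
apply: (IH n' r' (fun j => u (m + j) - y) 2 (fun j => 0 < j)); try lia.
- split=> [i j ij||j jn|j|]; try lia.
  + by have := umono (m + i) (m + j) ltac:(lia); lia.
  + by have := umono m (m + 1) ltac:(lia); lia.
  + by have := ulow (m + j) ltac:(lia); lia.
  + by have := ur (m + j); lia.
- by split=> // -[|[|j]].
- by have := umono m (m + 1) ltac:(lia) => /=; lia.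
Qed.

End MainRecursion.

(** * Admissible Delannoy paths *)

(** Enumerates by first step, so that sums over bounded sequences unfold along the recursion of
    [delannoy_poly]. *)
Fixpoint step_seqs (k : nat) : seq (seq step) :=
  if k is k'.+1 then
    [::] :: [seq s :: p | s <- [:: East; North; Diag], p <- step_seqs k']
  else [:: [::]].

Lemma step_seqsS k : step_seqs k.+1 =
  [::] :: [seq s :: p | s <- [:: East; North; Diag], p <- step_seqs k].
Proof. by []. Qed.

Lemma mem_step_seqs k p : (p \in step_seqs k) = (size p <= k).
Proof.
elim: k p => [|k IH] [|s p]; rewrite ?step_seqsS ?inE // [RHS]ltnS -IH orFb.
apply/allpairsP/idP => [[[s' p'] /= [_ p'k [_ ->]]] //|pk].
by exists (s, p); split=> //; case: s.
Qed.

Lemma step_seqs_uniq k : uniq (step_seqs k).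
Proof.
elim: k => // k IH; rewrite step_seqsS cons_uniq; apply/andP; split.
  by apply/negP => /allpairsP[[s p] [_ _]].
by apply: allpairs_uniq => // -[s p] [s' p'] _ _ [-> ->].
Qed.

Lemma sum_bseq (V : nmodType) k (P : pred (seq step)) (f : seq step -> V) :
  (\sum_(p : k.-bseq step | P p) f p = \sum_(p <- step_seqs k | P p) f p)%R.
Proof.
have pe : perm_eq (map val (index_enum (k.-bseq step))) (step_seqs k).
  apply: uniq_perm; [|exact: step_seqs_uniq|].
    by rewrite map_inj_uniq ?index_enum_uniq //; exact: val_inj.
  move=> p; rewrite mem_step_seqs; apply/mapP/idP => [[q _ ->]|pk].
    exact: size_bseq.
  by exists (Bseq pk); rewrite ?mem_index_enum.
by rewrite -(perm_big _ pe) big_map.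
Qed.

Section SchubertRegion.
Variables (n : nat) (U : {set 'I_n}).

Lemma height_le (P : {set 'I_n}) k : height P k <= minn k #|P|.
Proof.
have := height_slope P (leq0n k); rewrite height0.
by have := height_slope P (leq_maxl k n); rewrite (height_full P (leq_maxr k n)); lia.
Qed.

Lemma height_top a k : k <= n -> height [set i : 'I_n | a <= i] k = k - a.
Proof.
elim: k => [|k IH] kn; first by rewrite height0.
by rewrite (heightS _ (Ordinal kn)) /= IH ?inE /=; lia.
Qed.

Lemma card_le_n : #|U| <= n.
Proof. by rewrite -[n in _ <= n]card_ord max_card. Qed.

(** The lower boundary runs east to abscissa [n - r] and then north, so below the upper path only
    the abscissa matters. *)
Lemma in_region_cell x y : y <= height U (x + y) -> in_region U x y = (x + #|U| <= n).
Proof.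
move=> yU; have := height_le U (x + y); have rn := card_le_n => hU.
rewrite /in_region yU andbT; have [xyn|xyn] := leqP (x + y) n; last by lia.
by rewrite height_top // andTb; lia.
Qed.

(** Strictly below the upper path, the segment to the north is in the region and not on that path.
    On the path, it either is a vertical step of the path or leaves the region. *)
Lemma north_allowed_cell x y : y <= height U (x + y) -> x + #|U| <= n ->
  north_allowed U x y = (y < height U (x + y)).
Proof.
move=> yU xr; have hk k := height_le U k; have hxy := hk (x + y).
rewrite /north_allowed; have [yU'|yU'] := ltnP.
  have hS := height_step U (x + y).
  rewrite in_region_cell ?addnS ?xr; last by lia.
  apply/existsP => -[k /and3P[_ /eqP xk /eqP yk]].
  have Ek : x + y = k by have := hk k; lia.
  by rewrite Ek -yk ltnn in yU'.
apply/negP => /andP[/and3P[xyn _ yU1] /existsP].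
have kn : x + y < n by rewrite addnS in xyn.
apply; exists (Ordinal kn); have := heightS U (Ordinal kn); rewrite /= -addnS.
by case: (_ \in U) => /=; lia.
Qed.

Lemma admissible_from_region x y p : admissible_from U x y p -> in_region U x y.
Proof. by case: p => [|[] p] /= /andP[]. Qed.

(** The hypothesis is preserved by allowed steps; under it, admissibility reduces to the two tests
    made by [delannoy_poly]. *)
Lemma sum_admissible k x y : y <= height U (x + y).-1 ->
  (\sum_(p <- step_seqs k | admissible_from U x y p) 'X^(count_mem Diag p)
    = delannoy_poly (height U) n #|U| k x y)%R.
Proof.
have mono i j : i <= j -> height U i <= height U j by move=> ij; have := height_slope U ij; lia.
have rn := card_le_n.
have end_cell x' : x' + #|U| <= n -> (x' == n - #|U|) = (x' + #|U| == n) by lia.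
elim: k x y => [|k IH] x y yU; have yU' := leq_trans yU (mono _ _ (leq_pred _));
  have reg := in_region_cell yU'; (have [xr|xr] := leqP (x + #|U|) n; last first);
  try (by rewrite delannoy_poly_out // big1 // => p /admissible_from_region; rewrite reg leqNgt xr).
- rewrite big_mkcond big_seq1 /= reg xr end_cell //= addr0.
  by case: (_ && _).
rewrite big_mkcond step_seqsS big_cons big_allpairs_dep !big_cons big_nil /=.
rewrite reg xr end_cell //= addr0; congr (_ + _)%R; first by case: (_ && _).
rewrite -big_mkcond /= IH; last by apply: leq_trans yU _; apply: mono; lia.
congr (_ + _)%R; rewrite north_allowed_cell //; case: ltnP => yU1 /=.
  rewrite -!big_mkcond /= IH; last by rewrite addnS.
  congr (_ + _)%R; rewrite -IH; last first.
    by rewrite addSn addnS /=; apply: leq_trans yU1 (mono _ _ (leqnSn _)).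
  rewrite mulr_sumr; apply: eq_bigr => p _.
  by rewrite add1n exprS.
by rewrite !big1 ?addr0.
Qed.

Lemma count_diag_admissible x y p :
  admissible_from U x y p -> count_mem Diag p + y <= #|U|.
Proof.
elim: p x y => [|s p IH] x y /=; first by case/and3P=> _ _ /eqP ->.
case: s => /andP[_]; first by move/IH; rewrite /=; lia.
  by case/andP=> _ /IH /=; lia.
by case/andP=> _ /IH /=; lia.
Qed.

Lemma delannoy_count_sum : 0 < #|U| -> 0 < height U 1 ->
  (\sum_(1 <= i < #|U|.+1) (delannoy_count U i.-1)%:R *: 'X^i
    = 'X * delannoy_poly (height U) n #|U| n 1 1 :> {poly int})%R.
Proof.
move=> r0 U1; rewrite -sum_admissible // -sum_bseq mulr_sumr.
case Er: #|U| r0 => [//|r'] _.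
(* Starting at height 1, an admissible path has at most [r'] diagonal steps, so [inord] loses
   nothing. *)
rewrite (partition_big (fun p : n.-bseq step => inord (count_mem Diag p) : 'I_r'.+1) xpredT) //=.
rewrite big_add1 big_mkord; apply: eq_bigr => i _ /=.
rewrite scaler_nat -sumr_const; apply: eq_big => [p|p]; last first.
  by rewrite inE => /andP[_ /eqP <-]; rewrite exprS.
rewrite inE /admissible; case: (boolP (admissible_from _ _ _ _)) => //= pA.
have := count_diag_admissible pA; rewrite Er addn1 => pr.
by rewrite -val_eqE /= inordK.
Qed.

End SchubertRegion.

(** * Schubert matroids as strips *)

(** The strip is the single cell at the origin, which every path respects; its corner is the
    starting point (1, 1) of the Delannoy paths. *)
Lemma schubert_strip n (U : {set 'I_n}) : 1 < n -> 0 < height U 1 ->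
  schubert U = strip n #|U| (height U) 2 (fun j => 0 < j).
Proof.
move=> n1 U1; apply: val_inj => /=.
have inU B : (B \in schubert_bases U) = (B \in strip_bases n #|U| (height U) 2 (fun j => 0 < j)).
  rewrite inE; apply/andP/lpm_basesP => [[/eqP BU /(gale_leP (esym BU)) H]|/strip_basesP[Bn _ H]].
    apply/strip_basesP; split=> [|[|[|//]] jn _|j jn j2].
    - by rewrite height_full.
    - by rewrite height0.
    - by have := height_step B 0; rewrite height0; lia.
    - exact: H.
  have BU : #|B| = #|U| by rewrite -Bn height_full.
  split; first by rewrite BU.
  apply/gale_leP => // k; have [nk|kn] := leqP n k; first by rewrite !height_full // BU.
  case: k kn => [|[|k]] kn; first by rewrite !height0.
    by have := height_step B 0; rewrite height0; lia.
  exact: H.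
rewrite -[RHS]/(bases _) (@bases_lpm _ _ _ U); first by apply/setP => B; exact: inU.
  by rewrite /strip_lo /strip_up eqxx.
by rewrite -/(strip_bases _ _ _ _ _) -inU inE eqxx; apply/gale_leP.
Qed.

(** The path of [U] is the highest one. As some basis contains the first element, it starts north;
    as some basis avoids the last, it has full height one step before the end, and unit slopes give
    the strict bound. *)
Lemma schubert_upper_bound n (U : {set 'I_n}) : 0 < n ->
  loopless (schubert U) -> coloopless (schubert U) ->
  0 < height U 1 /\ upper_bound n #|U| (height U).
Proof.
case: n U => // n U _ hl hc.
have U1 : 0 < height U 1.
  have /forall_inPn[B] := hl ord0; rewrite inE negbK => /andP[/eqP BU /(gale_leP (esym BU)) H] B0.
  by apply: leq_trans (H 1); rewrite (heightS B ord0) B0 addn1.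
have Un : height U n = #|U|.
  have /forall_inPn[B] := hc ord_max; rewrite inE => /andP[/eqP BU /(gale_leP (esym BU)) H] Bn.
  have E : #|B| = height B n.
    by rewrite -(height_full B (leqnn n.+1)) (heightS B ord_max) (negbTE Bn) addn0.
  by have := H n; have := height_le U n; lia.
split=> //; split=> // [i j ij|j jn|j|]; last by have := height_le U n; rewrite Un; lia.
- by have := height_slope U ij; lia.
- by have := height_slope U (ltac:(lia) : j <= n); lia.
- by have := height_le U j; lia.
Qed.

Local Open Scope ring_scope.

Theorem theorem3p4 (R : realType)
    (g : forall E : finType, matroid E -> {poly int})
    (hg : is_g_polynomial R g)
    (n r : nat) (hn : (0 < n)%N) (U : {set 'I_n}) (hr : #|U| = r)
    (hl : loopless (schubert U)) (hc : coloopless (schubert U)) :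
  g 'I_n (schubert U) =
    \sum_(1 <= i < r.+1) (delannoy_count U i.-1)%:R *: 'X^i.
Proof.
have [U1 ub] := schubert_upper_bound hn hl hc.
have U0 : (0 < #|U|)%N by have := height_le U 1; lia.
have n1 : (1 < n)%N by have [_ _ _ _] := ub; lia.
rewrite -hr delannoy_count_sum // schubert_strip //.
have [_ _ _ _ rn] := ub.
apply: (g_strip hg (m := 2) (c := fun j => (0 < j)%N)) => //=; try lia.
  by split=> // -[|[|j]].
by rewrite addn1 add2n ltnS.
Qed.
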